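(* Let $k>1$ be an integer, consider an admissible figure (for this $k$) consisting of $n$ tiles, and let $G\le S_n$ be its puzzle group. Then: 1. If $k$ is even and $n\neq 6$, then $G=A_n$ if $k\equiv 0 \pmod 4$, and $G=S_n$ if $k\equiv 2\pmod 4$. 2. If $k$ is odd and $n\neq 12$, color the figure as a checkerboard in black and white, and suppose there are $m$ black tiles and $n-m$ white tiles (so $G$ may be regarded as a subgroup of $S_m\times S_{n-m}$, permuting the black tiles among themselves and the white tiles among themselves). Then $G=A_m\times A_{n-m}$ if $k\equiv 1,7\pmod 8$, and $G=\mathrm{Even}(S_m\times S_{n-m})$ if $k\equiv 3,5\pmod 8$, where $\mathrm{Even}(S_m\times S_{n-m})=(A_m\times A_{n-m})\cup\big((S_m\setminus A_m)\times(S_{n-m}\setminus A_{n-m})\big)$ is the set of all even permutations in $S_m\times S_{n-m}$. 3. If $n=6$, then under an appropriate labeling of the six tiles by the points of the projective line over $\mathbb{Z}_5$, $G=PGL_2(5)$ (acting by fractional linear transformations $z\mapsto \frac{az+b}{cz+d}$ with $a,b,c,d\in\mathbb{Z}_5$, $ad-bc\neq 0$), and $PGL_2(5)\cong S_5$. If $k=3$ and $n=12$, then $G\cong S_6$, and the restriction (projection) of $G$ to each of its two orbits is the full symmetric group $S_6$ on that orbit.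
   Context: Tiles are unit squares of the integer grid in the plane. For a fixed integer $k\ge 1$, an arrangement (figure) of tiles is called admissible if it can be formed by successively placing grid-aligned $k\times(k+1)$ and/or $(k+1)\times k$ rectangles of tiles such that each new rectangle overlaps the union of the previously placed rectangles in at least one tile when $k$ is even, and in at least two adjacent tiles when $k$ is odd. A move consists of rotating clockwise by $90^\circ$ the tiles in any $k\times k$ square block of tiles that is contained in the figure; each such move is a permutation of the $n$ tiles of the figure. The puzzle group $G$ of the figure is the subgroup of the symmetric group $S_n$ (on the set of tiles) generated by all such moves. $A_n$ denotes the alternating group. *)

(* Defs.v *)
From mathcomp Require Import all_boot all_order all_algebra.
From mathcomp Require Import all_fingroup all_solvable.
From mathcomp Require Import finmap ring.

Set Implicit Arguments.
Unset Strict Implicit.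
Unset Printing Implicit Defensive.

Import GRing.Theory.

Local Open Scope fset_scope.
Local Open Scope ring_scope.

(** * Figures *)

(* The tile (x, y) is the unit square [x, x+1] x [y, y+1], y pointing up. *)
Notation tile := (int * int)%type.

Definition figure := {fset tile}.

Definition rect (w h : nat) (p : tile) : figure :=
  [fset (p.1 + (val i)%:Z, p.2 + (val j)%:Z) | i : 'I_w, j : 'I_h].

Definition adjacent (s t : tile) : bool :=
  (`|s.1 - t.1| + `|s.2 - t.2| == 1)%N.

Definition is_piece (k : nat) (R : figure) : Prop :=
  exists p : tile, R = rect k k.+1 p \/ R = rect k.+1 k p.

Definition overlaps (k : nat) (F R : figure) : Prop :=
  if odd k then
    exists s t : tile,
      [/\ s \in F `&` R, t \in F `&` R & adjacent s t]
  else exists t : tile, t \in F `&` R.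

Inductive admissible (k : nat) : figure -> Prop :=
| admissible_piece (R : figure) : is_piece k R -> admissible k R
| admissible_add (F R : figure) :
    admissible k F -> is_piece k R -> overlaps k F R ->
    admissible k (F `|` R).

(** * The puzzle group *)

Definition block (k : nat) (p : tile) : figure := rect k k p.

(* Clockwise quarter turn of the k x k block with lower-left tile p: the tile
   at offset (i, j) from p goes to offset (j, k - 1 - i). *)
Definition turn (k : nat) (p t : tile) : tile :=
  if t \in block k p
  then (p.1 + (t.2 - p.2), p.2 + (k%:Z - 1 - (t.1 - p.1)))
  else t.

(* Since k > 0, a block contained in F has its lower-left tile in F, so it is
   enough to let p range over the tiles of F. *)
Definition moves (k : nat) (F : figure) : {set {perm F}} :=
  [set s : {perm F} |
    [exists p : F, (block k (val p) `<=` F)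
                && [forall t : F, val (s t) == turn k (val p) (val t)]]].

Definition puzzle_group (k : nat) (F : figure) : {group {perm F}} :=
  <<moves k F>>%G.

(* The two values of c are the two ways of naming the colours. *)
Definition black (c : bool) (F : figure) : {set F} :=
  [set t : F | odd (absz ((val t).1 + (val t).2)) == c].

(** * Permutation groups *)

(* The permutations supported in A; [Sym] alone now refers to 'Sym_T. *)
Notation sym_on A := (perm.Sym A).

Definition alt_on (T : finType) (A : {set T}) : {set {perm T}} :=
  [set s in sym_on A | ~~ odd_perm s].

Definition even_prod (T : finType) (A B : {set T}) : {set {perm T}} :=
  ((alt_on A * alt_on B)
     :|: ((sym_on A :\: alt_on A) * (sym_on B :\: alt_on B)))%g.

(** * PGL_2 acting on the projective line *)

(* Some z is the affine point z and None is the point at infinity. *)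
Definition proj_line (K : finFieldType) : finType := option K.

Definition moebius (K : finFieldType) (a b c d : K) (z : proj_line K) :
    proj_line K :=
  match z with
  | Some x => if c * x + d == 0 then None
              else Some ((a * x + b) / (c * x + d))
  | None => if c == 0 then None else Some (a / c)
  end.

Definition PGL2 (K : finFieldType) : {set {perm proj_line K}} :=
  [set s : {perm proj_line K} |
    [exists a : K, exists b : K, exists c : K, exists d : K,
      (a * d - b * c != 0) && [forall z, s z == moebius a b c d z]]].

Lemma moebius_comp (K : finFieldType) (a b c d a' b' c' d' : K) z :
  a * d - b * c != 0 ->
  moebius a' b' c' d' (moebius a b c d z)
  = moebius (a' * a + b' * c) (a' * b + b' * d)
            (c' * a + d' * c) (c' * b + d' * d) z.
Proof.
move=> h; pose frac (u v : K) := if v == 0 then None else Some (u / v).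
have fracE a1 b1 c1 d1 u v : (u != 0) || (v != 0) ->
    moebius a1 b1 c1 d1 (frac u v) = frac (a1 * u + b1 * v) (c1 * u + d1 * v).
  rewrite /frac; have [-> /= | v0 _ /=] := eqVneq v 0.
    rewrite orbF !mulr0 !addr0 => u0; rewrite mulf_eq0 (negPf u0) orbF.
    by case: eqP => // /eqP c0; rewrite -mulf_div divff // mulr1.
  have e x y : x * (u / v) + y = (x * u + y * v) / v.
    by rewrite mulrDl mulfK // mulrA.
  rewrite !e mulf_eq0 invr_eq0 (negPf v0) orbF.
  by case: eqP => // /eqP w0; rewrite invf_div mulrA divfK.
case: z => [x|].
  have fE a1 b1 c1 d1 : moebius a1 b1 c1 d1 (Some x)
      = frac (a1 * x + b1) (c1 * x + d1) by [].
  rewrite !fE fracE; first by congr frac; ring.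
  apply: contraNT h; rewrite negb_or !negbK => /andP[/eqP u0 /eqP v0].
  apply/eqP; transitivity (a * (c * x + d) - c * (a * x + b)); first by ring.
  by rewrite u0 v0 !mulr0 subr0.
have fE a1 b1 c1 d1 : moebius a1 b1 c1 d1 None = frac a1 c1 by [].
rewrite !fE fracE //; apply: contraNT h; rewrite negb_or !negbK.
by case/andP=> /eqP-> /eqP->; rewrite mul0r mulr0 subr0.
Qed.

Lemma PGL2P (K : finFieldType) (s : {perm proj_line K}) :
  reflect (exists a b c d, a * d - b * c != 0 /\ s =1 moebius a b c d)
          (s \in PGL2 K).
Proof.
rewrite inE; apply: (iffP existsP) => [[a /existsP[b /existsP[c /existsP[d]]]]|].
  by case/andP=> h /forallP e; exists a, b, c, d; split=> // z; apply/eqP.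
case=> a [b [c [d [h e]]]]; exists a; apply/existsP; exists b.
apply/existsP; exists c; apply/existsP; exists d; rewrite h /=.
by apply/forallP=> z; rewrite e.
Qed.

Lemma PGL2_group_set (K : finFieldType) : group_set (PGL2 K).
Proof.
apply/group_setP; split=> [|s t].
  apply/PGL2P; exists 1, 0, 0, 1; rewrite !mulr1 mulr0 subr0 oner_neq0.
  split=> // -[x|]; rewrite perm1 /= ?eqxx //.
  by rewrite mul0r add0r oner_eq0 mul1r addr0 divr1.
case/PGL2P=> a [b [c [d [h es]]]] /PGL2P[a' [b' [c' [d' [h' et]]]]].
apply/PGL2P; eexists _, _, _, _; split; last first.
  by move=> z; rewrite permM es et moebius_comp.
rewrite (_ : _ - _ = (a' * d' - b' * c') * (a * d - b * c)); last by ring.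
by rewrite mulf_neq0.
Qed.

Canonical PGL2_group (K : finFieldType) := Group (PGL2_group_set K).

(* Main.v *)
(** Let [a], [b] be the two turns of a k x (k+1) piece.  The permutations
    [a b^-1] and [a^-1 b] are diagonal translations where defined, so [a] and
    [b] act transitively on the piece (k even) or on each of its colours (k
    odd).  To find a 3-cycle, note that [(ab)^2] fixes the inner tiles and
    shifts the 3k - 1 tiles of a U-shaped path along three sides cyclically by
    k + 1 steps; hence [(ab)^6] shifts that path by 4 whatever k is, and
    [(ba)^6] does the same on the opposite U.  The commutator of the two only
    moves 24 tiles near the corners, and for k >= 10 its support meets that of
    a suitable conjugate in one tile, so that the commutator of the two
    conjugates is a 3-cycle.  For 4 <= k <= 9, and for two distinct overlapping
    pieces when k = 2 or 3, a 3-cycle is given by an explicit word.  Consider a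
    set containing that 3-cycle, all of whose 3-cycles are in the group, and
    maximal as such: a group element fixing one of its tiles preserves it.
    Since [a] fixes the last column of the piece and [b] the first, the set
    contains the whole piece or colour class, and 3-cycles spread from piece to
    piece through common tiles.  The upper bounds come from the colours and the
    parity of a turn, a product of 4-cycles with the lower left quarter of its
    block as transversal.  When n = 6 the two turns are explicit Moebius
    transformations generating PGL_2(5), which permutes the five factors of a
    1-factorization of K_6; when k = 3 and n = 12 the actions on the two colours
    differ by the outer automorphism of S_6. *)

Require Import Defs.
From mathcomp Require Import all_boot all_order all_algebra.
From mathcomp Require Import all_fingroup all_solvable.
From mathcomp Require Import finmap.
From mathcomp Require Import zify ring.

Set Implicit Arguments.
Unset Strict Implicit.
Unset Printing Implicit Defensive.

Import GroupScope.
Local Open Scope nat_scope.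

(** * 3-cycles in permutation groups *)

Section ThreeCycles.
Variable T : finType.
Implicit Types (x y z : T) (A B : {set T}) (s g h : {perm T}) (G : {group {perm T}}).

Definition cycle3 x y z : {perm T} := (tperm x y * tperm x z)%g.

Lemma cycle3E x y z : x != y -> y != z -> x != z ->
  [/\ cycle3 x y z x = y, cycle3 x y z y = z & cycle3 x y z z = x].
Proof.
move=> xy yz xz; rewrite /cycle3 !permM tpermL tpermR tpermL.
by rewrite [tperm x y z]tpermD // tpermR [tperm x z y]tpermD // eq_sym.
Qed.

Lemma cycle3_out x y z t : t != x -> t != y -> t != z -> cycle3 x y z t = t.
Proof. by move=> tx ty tz; rewrite permM !tpermD // eq_sym. Qed.

Lemma cycle3_rot x y z : x != y -> y != z -> x != z -> cycle3 x y z = cycle3 y z x.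
Proof.
move=> xy yz xz; apply/permP=> t.
have [Ex Ey Ez] := cycle3E xy yz xz.
have [Fy Fz Fx] : [/\ cycle3 y z x y = z, cycle3 y z x z = x & cycle3 y z x x = y].
  by apply: cycle3E; rewrite // eq_sym.
have [->|tx] := eqVneq t x; first by rewrite Ex Fx.
have [->|ty] := eqVneq t y; first by rewrite Ey Fy.
have [->|tz] := eqVneq t z; first by rewrite Ez Fz.
by rewrite !cycle3_out.
Qed.

Lemma cycle3J x y z g : (cycle3 x y z ^ g)%g = cycle3 (g x) (g y) (g z).
Proof. by rewrite /cycle3 conjMg !tpermJ. Qed.

Lemma cycle3_eq s x y z : x != y -> y != z -> x != z ->
  s x = y -> s y = z -> s z = x ->
  (forall t, t != x -> t != y -> t != z -> s t = t) -> s = cycle3 x y z.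
Proof.
move=> xy yz xz sx sy sz so; apply/permP=> t.
have [Ex Ey Ez] := cycle3E xy yz xz.
have [->|tx] := eqVneq t x; first by rewrite Ex sx.
have [->|ty] := eqVneq t y; first by rewrite Ey sy.
have [->|tz] := eqVneq t z; first by rewrite Ez sz.
by rewrite cycle3_out // so.
Qed.

Lemma cycle3_comm g h x :
    g x != x -> h x != x -> (forall t, g t != t -> h t != t -> t = x) ->
  [~ g, h] = cycle3 x (h x) (g x).
Proof.
move=> gx hx gh.
have fh t : t != x -> g t != t -> h t = t.
  by move=> tx gt; apply: contraNeq tx => ht; rewrite (gh t).
have fg t : t != x -> h t != t -> g t = t.
  by move=> tx ht; apply: contraNeq tx => gt; rewrite (gh t).
have hgx : h (g x) = g x by rewrite fh // (inj_eq perm_inj).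
have ghx : g (h x) = h x by rewrite fg // (inj_eq perm_inj).
have hgN : h x != g x.
  by rewrite -ghx (inj_eq perm_inj).
have kg s t : s t = t -> s^-1%g t = t by move=> {1}<-; rewrite permK.
apply: cycle3_eq => //; rewrite 1?eq_sym //.
- rewrite commgEl /conjg !permM.
  have -> : h^-1 (g^-1 x) = g^-1 x.
    have gN : g^-1 x != x by apply: contraNneq gx => {1}<-; rewrite permKV.
    by apply: kg; apply: fh; rewrite // permKV eq_sym.
  by rewrite permKV.
- by rewrite commgEl /conjg !permM (kg _ _ ghx) permK hgx.
- have hN : h^-1 x != x by apply: contraNneq hx => {1}<-; rewrite permKV.
  by rewrite commgEl /conjg !permM permK fg ?permKV // eq_sym.
- move=> t tx thx tgx; rewrite commgEl /conjg !permM.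
  have [gt|gt] := eqVneq (g t) t.
    rewrite (kg _ _ gt).
    have [ht|ht] := eqVneq (h t) t; first by rewrite (kg _ _ ht) gt.
    rewrite fg ?permKV //.
      by apply: contraNneq thx => <-; rewrite permKV.
    by apply: contraNneq ht => {1}->; rewrite permKV.
  have ht := fh _ tx gt.
  have e : h (g^-1 t) = g^-1 t.
    apply: fh; first by apply: contraNneq tgx => <-; rewrite permKV.
    by rewrite permKV eq_sym; apply: contraNneq gt => {1}<-; rewrite permKV.
  by rewrite (kg _ _ e) permKV fh.
Qed.

Lemma comm_neq g h x :
    g x != x -> h x != x -> (forall t, g t != t -> h t != t -> t = x) ->
  h x != g x.
Proof.
move=> gx hx gh; apply: contraNneq gx => e; apply/eqP.
have ggx : g (g x) != g x by rewrite (inj_eq perm_inj) -e.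
have hgx : h (g x) != g x by rewrite -{2}e (inj_eq perm_inj) -e.
exact: gh.
Qed.

Definition tri (G : {set {perm T}}) A :=
  forall x y z, x \in A -> y \in A -> z \in A ->
    x != y -> y != z -> x != z -> cycle3 x y z \in G.

Lemma triS G A B : A \subset B -> tri G B -> tri G A.
Proof. by move=> /subsetP AB tB x y z /AB xB /AB yB /AB; apply: tB. Qed.

Lemma tri_imset G A g : g \in G -> tri G A -> tri G (g @: A).
Proof.
move=> gG tA _ _ _ /imsetP[x xA ->] /imsetP[y yA ->] /imsetP[z zA ->].
by rewrite !(inj_eq perm_inj) -cycle3J => xy yz xz; rewrite groupJ // tA.
Qed.

Lemma tri_cycle3 G x y z : x != y -> y != z -> x != z ->
  cycle3 x y z \in G -> tri G [set x; y; z].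
Proof.
move=> xy yz xz xyzG.
have E1 : cycle3 y z x = cycle3 x y z by rewrite -cycle3_rot.
have E2 : cycle3 z x y = cycle3 x y z by rewrite -E1 -cycle3_rot // eq_sym.
have F : cycle3 x z y = (cycle3 x y z)^-1%g by rewrite /cycle3 invMg !tpermV.
have F1 : cycle3 z y x = cycle3 x z y by rewrite -cycle3_rot // eq_sym.
have F2 : cycle3 y x z = cycle3 x z y by rewrite -F1 -cycle3_rot // eq_sym.
have FG : cycle3 x z y \in G by rewrite F groupV.
move=> u v w; rewrite !inE -!orbA.
by case/or3P=> /eqP-> /or3P[]/eqP-> /or3P[]/eqP->; rewrite ?eqxx //= => _ _ _;
  rewrite ?E1 ?E2 ?F1 ?F2.
Qed.

Lemma tri_comm G g h x : g \in G -> h \in G ->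
    g x != x -> h x != x -> (forall t, g t != t -> h t != t -> t = x) ->
  tri G [set x; h x; g x] /\ 2 < #|[set x; h x; g x]|.
Proof.
move=> gG hG gx hx gh; have hg := comm_neq gx hx gh.
split; last by rewrite -setUA cardsU1 cards2 !inE negb_or hg 2!(eq_sym x) hx gx.
apply: tri_cycle3; rewrite // 1?eq_sym //.
by rewrite -cycle3_comm // groupR.
Qed.

Lemma exists_third A x y : 2 < #|A| -> exists2 z, z \in A & (z != x) && (z != y).
Proof.
move=> A3; have /card_gt0P[z] : 0 < #|A :\: [set x; y]|.
  rewrite cardsD subn_gt0; apply: leq_ltn_trans A3.
  apply: (leq_trans (subset_leq_card (subsetIr _ _))).
  by rewrite cards2; case: (x != y).
by rewrite !inE negb_or => /andP[] /andP[zx zy] zA; exists z; rewrite // zx.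
Qed.

Lemma tri_adjoin G A p x : 2 < #|A| -> tri G A -> p \in A -> x \notin A ->
  tri G (x |: A :\ p) -> tri G (x |: A).
Proof.
move=> A3 tA pA xA tx.
have main v w : v \in A -> w \in A -> v != w -> cycle3 x v w \in G.
  move=> vA wA vw.
  have xN u : u \in A -> x != u by move=> uA; apply: contraNneq xA => ->.
  have [z zA /andP[zv zw]] := exists_third v w A3.
  case: (eqVneq v p) => [vp|vp].
    rewrite vp in vA vw zv *.
    have wp : w != p by rewrite eq_sym.
    have [Ez Ew _] := cycle3E zw wp zv.
    have Ex : cycle3 z w p x = x by rewrite cycle3_out // xN.
    rewrite -[p]Ew -[X in cycle3 _ _ X]Ez -{1}Ex -cycle3J groupJ //; last exact: tA.
    apply: tx; rewrite ?xN ?inE ?eqxx ?wp ?zv ?zA ?wA ?orbT //.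
    by rewrite eq_sym.
  case: (eqVneq w p) => [wp|wp].
    rewrite wp in wA vw zw *.
    have [Ez Ev _] := cycle3E zv vw zw.
    have Ex : cycle3 z v p x = x by rewrite cycle3_out // xN.
    rewrite -[p]Ev -[X in cycle3 _ X _]Ez -{1}Ex -cycle3J groupJ //; last exact: tA.
    by apply: tx; rewrite ?xN ?inE ?eqxx ?vw ?zw ?zA ?vA ?orbT.
  by apply: tx; rewrite ?xN // ?inE ?eqxx // ?vp ?wp ?vA ?wA ?orbT.
move=> u v w; rewrite !inE.
case/predU1P=> [-> | uA].
  case/predU1P=> [-> | vA]; first by rewrite eqxx.
  case/predU1P=> [-> | wA]; first by rewrite eqxx.
  by move=> _ vw _; apply: main.
case/predU1P=> [-> | vA].
  case/predU1P=> [-> | wA]; first by rewrite eqxx.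
  move=> ux xw uw; rewrite cycle3_rot //; apply: main; rewrite // eq_sym //.
case/predU1P=> [-> | wA uv vw uw]; last exact: tA.
move=> uv vx ux; rewrite -cycle3_rot // 1?eq_sym //; exact: main.
Qed.

Lemma tri_merge G A B p : 2 < #|A| -> 2 < #|B| -> p \in A -> p \in B ->
  tri G A -> tri G B -> tri G (A :|: B).
Proof.
move=> + B3 + pB + tB.
have [n] := ubnP #|B :\: A|; elim: n A => // n IHn A le_n A3 pA tA.
have [/setUidPl-> // | ] := boolP (B \subset A).
case/subsetPn=> x xB xA.
have px : p != x by apply: contraNneq xA => <-.
suffices tx : tri G (x |: A).
  have -> : A :|: B = (x |: A) :|: B.
    by apply/setP=> t; rewrite !inE; case: eqP => // ->; rewrite xB !orbT.
  apply: IHn => //; last by rewrite !inE pA orbT.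
    rewrite -ltnS; apply: leq_trans _ le_n; rewrite ltnS; apply: proper_card.
    apply/properP; split; first by apply: setDS; apply: subsetUr.
    by exists x; rewrite !inE ?eqxx // xA.
  by rewrite cardsU1 xA ltnW.
have [y yB /andP[yp yx]] := exists_third p x B3.
have xp : x != p by rewrite eq_sym.
have xy : x != y by rewrite eq_sym.
have py : p != y by rewrite eq_sym.
apply: (@tri_adjoin G A p x) => //.
have [yA | yA] := boolP (y \in A).
  have cG : cycle3 p y x \in G by apply: tB.
  apply: triS (tri_imset cG tA).
  have [Ep Ey Ex] := cycle3E py yx px.
  apply/subsetP=> t; rewrite !inE => /predU1P[-> | /andP[tp tA']].
    by apply/imsetP; exists y.
  have [-> | ty] := eqVneq t y; first by apply/imsetP; exists p.
  apply/imsetP; exists t; rewrite // cycle3_out //.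
  by apply: contraNneq xA => <-.
have cG : cycle3 p x y \in G by apply: tB.
apply: triS (tri_imset cG tA).
have [Ep Ex Ey] := cycle3E px xy py.
apply/subsetP=> t; rewrite !inE => /predU1P[-> | /andP[tp tA']].
  by apply/imsetP; exists p.
apply/imsetP; exists t; rewrite // cycle3_out //.
  by apply: contraNneq xA => <-.
by apply: contraNneq yA => <-.
Qed.

Lemma tri_spread G A (H : {set {perm T}}) : 2 < #|A| -> tri G A ->
    H \subset G -> (forall h, h \in H -> exists2 x, x \in A & h x = x) ->
  exists D : {set T}, [/\ A \subset D, tri G D
              & forall x h, x \in D -> h \in <<H>> -> h x \in D].
Proof.
move=> + + HG; have [n] := ubnP #|~: A|; elim: n A => // n IHn A le_n A3 tA Hfix.
have [/forall_inP Hst | ] := boolP [forall h in H, h @: A \subset A].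
  exists A; split=> // x h xA hH.
  have : h @: A = A.
    apply/eqP; rewrite -(setactE 'P) eqEcard card_setact leqnn andbT.
    move: hH; have: <<H>> \subset 'N(A | 'P).
      rewrite gen_subG; apply/subsetP=> g gH; rewrite !inE.
      by apply/subsetP=> t tA'; rewrite inE; apply: (subsetP (Hst g gH)); apply: imset_f.
    by move=> /subsetP nA /nA/astabs_setact->.
  by move=> <-; apply: imset_f.
rewrite negb_forall_in => /exists_inP[h hH /subsetPn[y yhA yA]].
have [x xA hx] := Hfix h hH.
have hG := subsetP HG _ hH.
have tU : tri G (A :|: h @: A).
  apply: (@tri_merge _ _ _ x) => //; last exact: tri_imset.
    by rewrite card_imset //; apply: perm_inj.
  by rewrite -hx imset_f.
have [||g gH|D [sD tD DH]] := IHn _ _ _ tU.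
- rewrite -ltnS; apply: leq_trans _ le_n; rewrite ltnS; apply: proper_card.
  apply/properP; split; first by rewrite setCS subsetUl.
  by exists y; rewrite !inE // yhA orbT.
- by apply: leq_trans A3 (subset_leq_card (subsetUl _ _)).
- by have [z zA gz] := Hfix g gH; exists z; rewrite // inE zA.
by exists D; split=> //; apply: subset_trans sD; apply: subsetUl.
Qed.

Lemma mem_alt_on A s : (s \in alt_on A) = perm_on A s && ~~ odd_perm s.
Proof. by rewrite !inE. Qed.

Lemma odd_cycle3 x y z : x != y -> x != z -> odd_perm (cycle3 x y z) = false.
Proof. by move=> xy xz; rewrite /cycle3 odd_mul_tperm odd_tperm xy xz. Qed.

Lemma tri_alt_on G A : tri G A -> alt_on A \subset G.
Proof.
move=> tA; apply/subsetP=> s; rewrite mem_alt_on => /andP[sA os].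
have [n] := ubnP #|[set x | s x != x]|.
elim: n s sA os => // n IHn s sA os le_n.
have mem_A t : s t != t -> t \in A by move=> st; apply: (subsetP sA).
have [/eqP s1|] := boolP (s == 1%g); first by rewrite s1 group1.
move/eqP/permP/eqfunP; rewrite negb_forall => /existsP[x]; rewrite perm1 => sx.
have [z /and3P[zx zsx sz]] :
    exists z, [&& z != x, z != s x & s z != z].
  apply/existsP; apply: contraNT os; rewrite negb_exists => /forallP N.
  have -> : s = tperm x (s x).
    have fixo t : t != x -> t != s x -> s t = t.
      by move=> tx tsx; move: (N t); rewrite tx tsx /= negbK => /eqP.
    have ssx : s (s x) = x.
      have [//|ssx] := eqVneq (s (s x)) x.
      have := fixo _ ssx; rewrite (inj_eq perm_inj) => /(_ sx)/perm_inj/perm_inj.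
      by move/eqP; rewrite (negPf sx).
    apply/permP=> t; case: tpermP => [->|->|/eqP tx /eqP tsx] //.
    exact: fixo.
  by rewrite odd_tperm eq_sym sx.
have xA := mem_A x sx.
have sxA : s x \in A by apply: mem_A; rewrite (inj_eq perm_inj).
have zA := mem_A z sz.
have cG : cycle3 (s x) x z \in G.
  by apply: tA; rewrite // eq_sym.
have [E1 E2 E3] : [/\ cycle3 (s x) x z (s x) = x, cycle3 (s x) x z x = z
                    & cycle3 (s x) x z z = s x].
  by apply: cycle3E; rewrite // eq_sym.
rewrite -(groupMr _ cG); apply: IHn.
- apply/subsetP=> t; rewrite inE permM; apply: contraNT => tA'.
  have st : s t = t by apply: contraNeq tA' => /mem_A.
  rewrite st cycle3_out //; apply: contraNneq tA' => -> //.
- by rewrite odd_permM odd_cycle3 ?addbF // eq_sym.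
rewrite -ltnS; apply: leq_trans _ le_n; rewrite ltnS; apply: proper_card; apply/properP; split.
  apply/subsetP=> t; rewrite !inE permM; apply: contraNN => /eqP st.
  rewrite st cycle3_out //.
  - by apply: contraNneq sx => tsx; rewrite -(inj_eq (@perm_inj _ s)) -tsx st.
  - by apply: contraNneq sx => <-; rewrite st.
  by apply: contraNneq sz => <-; rewrite st.
by exists x; rewrite !inE // permM E1 eqxx.
Qed.

End ThreeCycles.

(** * Permutations in coordinates *)

Notation crd := (nat * nat)%type.

Definition rot (k u v : nat) (c : crd) : crd :=
  let: (x, y) := c in
  if [&& u <= x, x < u + k, v <= y & y < v + k]
  then (u + (y - v), v + (k.-1 - (x - u))) else (x, y).

Definition cdom (k : nat) (c : crd) : bool := (c.1 <= k) && (c.2 < k).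

Section Charts.
Variables (T : finType) (e : crd -> T) (dom : pred crd).
Implicit Types (s t : {perm T}) (f g : crd -> crd).

Definition acts s f : Prop :=
  (forall c, dom c -> dom (f c) /\ s (e c) = e (f c)) /\
  (forall x, s x != x -> exists2 c, dom c & x = e c).

Lemma acts_eq s f g : (forall c, dom c -> f c = g c) -> acts s f -> acts s g.
Proof. by move=> fg [sf so]; split=> // c dc; rewrite -fg //; apply: sf. Qed.

Lemma acts1 : acts 1 id.
Proof. by split=> [c dc | x]; rewrite perm1 // eqxx. Qed.

Lemma acts_mul s t f g : acts s f -> acts t g -> acts (s * t) (g \o f).
Proof.
move=> [sf so] [tg to]; split=> [c dc | x].
  by have [df ef] := sf c dc; have [dg eg] := tg _ df; rewrite permM ef eg.
rewrite permM; have [sx | sx _] := eqVneq (s x) x; last exact: so.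
by rewrite sx => /to.
Qed.

Lemma acts_inv s f g : acts s f ->
  (forall c, dom c -> dom (g c) /\ f (g c) = c) -> acts s^-1 g.
Proof.
move=> [sf so] fg; split=> [c dc | x sx].
  have [dg fgc] := fg c dc; split=> //; apply: (@perm_inj _ s).
  by have [_ ->] := sf _ dg; rewrite permKV fgc.
by apply: so; apply: contraNneq sx => {1}<-; rewrite permK.
Qed.

Lemma acts_exp s f n : acts s f -> acts (s ^+ n) (iter n f).
Proof.
move=> sf; elim: n => [|n IHn]; first exact: acts1.
by rewrite expgSr; apply: acts_mul.
Qed.

Hypothesis e_inj : {in dom &, injective e}.

Lemma acts_cycle3 s f p q r : acts s f ->
    dom p -> dom q -> dom r -> uniq [:: p; q; r] ->
    f p = q -> f q = r -> f r = p ->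
    (forall c, dom c -> c \notin [:: p; q; r] -> f c = c) ->
  s = cycle3 (e p) (e q) (e r).
Proof.
move=> [sf so] dp dq dr; rewrite /= !inE negb_or andbT => /andP[/andP[npq npr] nqr].
move=> fp fq fr ff; apply: cycle3_eq; rewrite ?(inj_in_eq e_inj) //.
- by have [_ ->] := sf _ dp; rewrite fp.
- by have [_ ->] := sf _ dq; rewrite fq.
- by have [_ ->] := sf _ dr; rewrite fr.
move=> t tp tq tr; apply/eqP; apply: contraT => st.
have [c dc tc] := so _ st; move: st tp tq tr; rewrite tc.
rewrite !(inj_in_eq e_inj) // => + cp cq cr.
by have [_ ->] := sf _ dc; rewrite ff ?eqxx // !inE !negb_or cp cq.
Qed.

End Charts.

Definition link (T : finType) (H : {set {perm T}}) (x y : T) : Prop :=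
  exists2 g, g \in <<H>> & g x = y.

Section Link.
Variables (T : finType) (H : {set {perm T}}).

Lemma link_refl x : link H x x.
Proof. by exists 1%g; rewrite ?group1 ?perm1. Qed.

Lemma link_sym x y : link H x y -> link H y x.
Proof. by case=> g gH <-; exists g^-1%g; rewrite ?groupV ?permK. Qed.

Lemma link_trans x y z : link H x y -> link H y z -> link H x z.
Proof.
by case=> g gH <- [h hH <-]; exists (g * h)%g; rewrite ?groupM ?permM.
Qed.

Lemma link_mem g x : g \in H -> link H x (g x).
Proof. by move=> gH; exists g; rewrite ?mem_gen. Qed.

End Link.

Section Piece.
Variables (T : finType) (k : nat) (e : crd -> T) (a b : {perm T}).
Hypothesis k1 : 1 < k.
Hypothesis e_inj : {in cdom k &, injective e}.
Hypothesis acts_a : acts e (cdom k) a (rot k 0 0).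
Hypothesis acts_b : acts e (cdom k) b (rot k 1 0).

Local Notation H := [set a; b].
Local Notation lk c d := (link H (e c) (e d)).

Lemma link_a c d : cdom k c -> rot k 0 0 c = d -> lk c d.
Proof.
move=> dc <-; have [_ <-] := acts_a.1 c dc.
by apply: link_mem; rewrite !inE eqxx.
Qed.

Lemma link_b c d : cdom k c -> rot k 1 0 c = d -> lk c d.
Proof.
move=> dc <-; have [_ <-] := acts_b.1 c dc.
by apply: link_mem; rewrite !inE eqxx orbT.
Qed.

Lemma link_antidiag i j : i < k -> j.+1 < k -> lk (i, j.+1) (i.+1, j).
Proof.
move=> ik jk; apply: (@link_trans _ _ _ (e (j.+1, k.-1 - i))).
  apply: link_a; rewrite /cdom /=; first by lia.
  by case: ifP => h; [congr pair; lia | lia].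
apply/link_sym/link_b; rewrite /cdom /=; first by lia.
by case: ifP => h; [congr pair; lia | lia].
Qed.

Lemma link_diag i j : i < k -> j.+1 < k -> lk (i, j) (i.+1, j.+1).
Proof.
move=> ik jk; apply: (@link_trans _ _ _ (e (k.-1 - j, i))).
  apply/link_sym/link_a; rewrite /cdom /=; first by lia.
  by case: ifP => h; [congr pair; lia | lia].
apply: link_b; rewrite /cdom /=; first by lia.
by case: ifP => h; [congr pair; lia | lia].
Qed.

Lemma link_corner i j : i <= k -> j < k -> lk (i, j) (0, odd (i + j) : nat).
Proof.
elim: i j => [|i IHi] j ik jk.
  rewrite add0n; elim/ltn_ind: j jk => -[|[|j]] IHj jk; try exact: link_refl.
  rewrite /= negbK; apply: link_trans (IHj j _ _); [|lia|lia].
  by apply: link_trans (link_antidiag _ _) (link_sym (link_diag _ _)); lia.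
have [jk' | jk'] := ltnP j.+1 k.
  rewrite addSnnS; apply: link_trans (IHi j.+1 _ _); [|lia|lia].
  by apply/link_sym/link_antidiag; lia.
case: j jk jk' => [|j] jk jk'; first by lia.
rewrite addSn addnS /= negbK; apply: link_trans (IHi j _ _); [|lia|lia].
by apply/link_sym/link_diag; lia.
Qed.

Lemma link_piece c d : cdom k c -> cdom k d ->
  (odd k -> odd (c.1 + c.2) = odd (d.1 + d.2)) -> lk c d.
Proof.
case: c d => [i j] [i' j'] /andP[/= ik jk] /andP[/= ik' jk'] cd.
apply: link_trans (link_corner ik jk) _.
apply: link_trans (link_sym (link_corner ik' jk')).
have [kodd | keven] := boolP (odd k); first by rewrite cd //; apply: link_refl.
have l01 : lk (0, 0) (0, 1).
  apply: (@link_trans _ _ _ (e (0, k.-1))).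
    apply: link_a; rewrite /cdom /=; first by lia.
    by case: ifP => h; [congr pair; lia | lia].
  have -> : 1 = odd (0 + k.-1) by lia.
  by apply: link_corner; lia.
case: odd; case: odd => //=; try exact: link_refl.
exact: link_sym.
Qed.

End Piece.

(** * A 3-cycle in a single piece *)

Section Cycles.
Variable k : nat.

(* Left column downwards, bottom row, right column upwards. *)
Definition path_tile (t : nat) : crd :=
  if t < k then (0, k.-1 - t)
  else if t <= k.*2.-1 then (t - k.-1, 0) else (k, t - k.*2.-1).

Definition turn2 (c : crd) : crd := rot k 1 0 (rot k 0 0 c).

Definition shift4 (c : crd) : crd :=
  let: (i, j) := c in
  if i == 0 then (if 4 <= j then (0, j - 4) else (4 - j, 0))
  else if i == k then (if j + 4 < k then (k, j + 4) else (0, k.*2 - 5 - j))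
  else if j == 0 then (if i + 4 <= k then (i + 4, 0) else (k, i + 4 - k))
  else (i, j).

Definition unshift4 (c : crd) : crd :=
  let: (i, j) := c in
  if i == 0 then (if j + 4 < k then (0, j + 4) else (k, k.*2 - 5 - j))
  else if i == k then (if 4 <= j then (k, j - 4) else (k + j - 4, 0))
  else if j == 0 then (if 4 < i then (i - 4, 0) else (0, 4 - i))
  else (i, j).

Lemma turn2_path t : 1 < k -> t < (3 * k).-1 ->
  turn2 (path_tile t) = path_tile ((t + 2 * k) %% (3 * k).-1).
Proof.
move=> k1 tk; have [tk1 | tk1] := ltnP t k.-1.
  rewrite modn_small; last by lia.
  rewrite /turn2 /path_tile /rot; repeat case: ifP => ?; try lia;
    congr pair; lia.
have -> : t + 2 * k = t - k.-1 + (3 * k).-1 by lia.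
rewrite modnDr modn_small; last by lia.
rewrite /turn2 /path_tile /rot; repeat case: ifP => ?; try lia;
  congr pair; lia.
Qed.

Lemma turn2_pathX n t : 1 < k -> t < (3 * k).-1 ->
  iter n turn2 (path_tile t) = path_tile ((t + n * (2 * k)) %% (3 * k).-1).
Proof.
move=> k1 tk; elim: n => [|n IHn]; first by rewrite addn0 modn_small.
rewrite iterS IHn turn2_path ?ltn_mod; try lia.
by rewrite modnDml -addnA [n.+1 * _]mulSnr.
Qed.

Lemma turn2_inner i j : 0 < i < k -> 0 < j < k -> turn2 (turn2 (i, j)) = (i, j).
Proof.
move=> ik jk; have E x y : 0 < x < k -> 0 < y < k -> turn2 (x, y) = (k - x, k - y).
  move=> xk yk; rewrite /turn2 /rot; repeat case: ifP => ?; try lia; congr pair; lia.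
by rewrite !E; [congr pair; lia | lia..].
Qed.

Lemma turn2_6 i j : 4 < k -> i <= k -> j < k ->
  iter 6 turn2 (i, j) = shift4 (i, j).
Proof.
move=> k4 ik jk.
have [inner | outer] := boolP [&& i != 0, i != k & j != 0].
  rewrite /= !turn2_inner; try lia.
  case/and3P: inner => i0 ik' j0.
  by rewrite (negPf i0) (negPf ik') (negPf j0).
have [t tk ->] : exists2 t, t < (3 * k).-1 & (i, j) = path_tile t.
  have [i0 | i0] := eqVneq i 0.
    exists (k.-1 - j); first by lia.
    by rewrite /path_tile; repeat case: ifP => ?; try lia; congr pair; lia.
  have [ik' | ik'] := eqVneq i k.
    exists (k.*2.-1 + j); first by lia.
    by rewrite /path_tile; repeat case: ifP => ?; try lia; congr pair; lia.
  exists (k.-1 + i); first by lia.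
  by rewrite /path_tile; repeat case: ifP => ?; try lia; congr pair; lia.
rewrite turn2_pathX; [|lia..].
have -> : t + 6 * (2 * k) = 4 * (3 * k).-1 + (t + 4) by lia.
rewrite modnMDl.
have [t4 | t4] := ltnP (t + 4) (3 * k).-1.
  rewrite modn_small // /path_tile /shift4.
  by repeat case: ifP => ?; try lia; congr pair; lia.
have -> : t + 4 = t + 4 - (3 * k).-1 + (3 * k).-1 by lia.
rewrite modnDr modn_small; last by lia.
rewrite /path_tile /shift4; repeat case: ifP => ?; try lia; congr pair; lia.
Qed.

End Cycles.

Section Reindex.
Variables (T : finType) (e : crd -> T) (dom : pred crd) (phi : crd -> crd).
Hypothesis phiK : forall c, dom c -> dom (phi c) /\ phi (phi c) = c.

Lemma acts_reindex s f :
  acts e dom s f -> acts (e \o phi) dom s (phi \o f \o phi).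
Proof.
move=> [sf so]; split=> [c dc | x /so[c dc ->]] /=.
  have [dp _] := phiK dc; have [df ef] := sf _ dp.
  by have [dpf ppf] := phiK df; split; rewrite // ef ppf.
by have [dp ppc] := phiK dc; exists (phi c); rewrite //= ppc.
Qed.

Lemma inj_reindex : {in dom &, injective e} -> {in dom &, injective (e \o phi)}.
Proof.
move=> e_inj c d dc dd /= /e_inj pcd.
have [dpc <-] := phiK dc; have [dpd <-] := phiK dd.
by rewrite pcd.
Qed.

End Reindex.

Section Turns.
Variable k : nat.

Definition half_turn (c : crd) : crd := (k - c.1, k.-1 - c.2).
Definition mirror (c : crd) : crd := (k - c.1, c.2).
Definition unrot (c : crd) : crd :=
  let: (x, y) := c in if x < k then (k.-1 - y, x) else (x, y).
Definition unrot1 (c : crd) : crd :=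
  let: (x, y) := c in if 0 < x then (k - y, x.-1) else (x, y).

Lemma half_turnK c : cdom k c -> cdom k (half_turn c) /\ half_turn (half_turn c) = c.
Proof.
case: c => i j /andP[/= ik jk]; rewrite /cdom /half_turn /=.
by split; [lia | congr pair; lia].
Qed.

Lemma mirrorK c : cdom k c -> cdom k (mirror c) /\ mirror (mirror c) = c.
Proof.
case: c => i j /andP[/= ik jk]; rewrite /cdom /mirror /=.
by split; [lia | congr pair; lia].
Qed.

Lemma unrotK c : cdom k c -> cdom k (unrot c) /\ rot k 0 0 (unrot c) = c.
Proof.
case: c => i j /andP[/= ik jk]; rewrite /cdom /unrot /rot.
by split; repeat case: ifP => /= ?; try lia; congr pair; lia.
Qed.

Lemma unrot1K c : cdom k c -> cdom k (unrot1 c) /\ rot k 1 0 (unrot1 c) = c.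
Proof.
case: c => i j /andP[/= ik jk]; rewrite /cdom /unrot1 /rot.
by split; repeat case: ifP => /= ?; try lia; congr pair; lia.
Qed.

Lemma half_turn_rot c : cdom k c -> half_turn (rot k 0 0 (half_turn c)) = rot k 1 0 c.
Proof.
case: c => i j /andP[/= ik jk]; rewrite /half_turn /rot.
by repeat case: ifP => /= ?; try lia; congr pair; lia.
Qed.

Lemma half_turn_rot1 c : cdom k c -> half_turn (rot k 1 0 (half_turn c)) = rot k 0 0 c.
Proof.
case: c => i j /andP[/= ik jk]; rewrite /half_turn /rot.
by repeat case: ifP => /= ?; try lia; congr pair; lia.
Qed.

Lemma mirror_unrot c : cdom k c -> mirror (unrot (mirror c)) = rot k 1 0 c.
Proof.
case: c => i j /andP[/= ik jk]; rewrite /mirror /unrot /rot.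
by repeat case: ifP => /= ?; try lia; congr pair; lia.
Qed.

Lemma mirror_unrot1 c : cdom k c -> mirror (unrot1 (mirror c)) = rot k 0 0 c.
Proof.
case: c => i j /andP[/= ik jk]; rewrite /mirror /unrot1 /rot.
by repeat case: ifP => /= ?; try lia; congr pair; lia.
Qed.

Definition vshift4 (c : crd) : crd :=
  let: (i, j) := c in
  if i == k then (if j + 4 < k then (k, j + 4) else (k.*2 - 5 - j, k.-1))
  else if i == 0 then (if 4 <= j then (0, j - 4) else (k, 3 - j))
  else if j == k.-1 then (if 4 <= i then (i - 4, k.-1) else (0, k + i - 5))
  else (i, j).

Definition vunshift4 (c : crd) : crd :=
  let: (i, j) := c in
  if i == k then (if 4 <= j then (k, j - 4) else (0, 3 - j))
  else if i == 0 then (if j + 4 < k then (0, j + 4) else (j + 5 - k, k.-1))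
  else if j == k.-1 then (if i + 4 < k then (i + 4, k.-1) else (k, k.*2 - 5 - i))
  else (i, j).

Hypothesis k9 : 9 < k.

Lemma unshift4K c : cdom k c -> cdom k (unshift4 k c) /\ shift4 k (unshift4 k c) = c.
Proof.
case: c => i j /andP[/= ik jk]; rewrite /cdom /shift4 /unshift4.
by split; repeat case: ifP => /= ?; try lia; congr pair; lia.
Qed.

Lemma vunshift4K c : cdom k c -> cdom k (vunshift4 c) /\ vshift4 (vunshift4 c) = c.
Proof.
case: c => i j /andP[/= ik jk]; rewrite /cdom /vshift4 /vunshift4.
by split; repeat case: ifP => /= ?; try lia; congr pair; lia.
Qed.

Lemma half_turn_shift4 c : cdom k c -> half_turn (shift4 k (half_turn c)) = vshift4 c.
Proof.
case: c => i j /andP[/= ik jk]; rewrite /half_turn /shift4 /vshift4.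
by repeat case: ifP => /= ?; try lia; congr pair; lia.
Qed.

Definition comm4 (c : crd) : crd := vshift4 (unshift4 k (vunshift4 (shift4 k c))).

Definition supp4 (c : crd) : bool :=
  let: (i, j) := c in
  ((i == 0) || (i == k)) && ((j < 4) || (k <= j + 4))
  || ((j == 0) || (j == k.-1)) && (k <= i + 4 < k + 4).

Lemma comm4_out i j : i <= k -> j < k -> ~~ supp4 (i, j) -> comm4 (i, j) = (i, j).
Proof.
move=> ik jk; rewrite /supp4 /comm4 /shift4.
repeat (case: ifP => ?; try lia);
 move=> N; rewrite /vunshift4;
 repeat (case: ifP => ?; try lia); rewrite /unshift4;
 repeat (case: ifP => ?; try lia); rewrite /vshift4;
 repeat (case: ifP => ?; try lia); congr pair; lia.
Qed.

Lemma supp4_conj i j : i <= k -> j < k -> supp4 (i, j) ->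
  supp4 (rot k 1 0 (rot k 1 0 (unrot (rot k 1 0 (rot k 0 0 (i, j)))))) ->
  (i, j) = (0, 0).
Proof.
move=> ik jk S1.
have {S1} : [\/ i = 0 /\ (j < 4 \/ k <= j + 4), i = k /\ (j < 4 \/ k <= j + 4)
           , j = 0 /\ k <= i + 4 < k + 4 | j = k.-1 /\ k <= i + 4 < k + 4].
  move: S1; rewrite /supp4 => /orP[/andP[/orP[]/eqP-> /orP hj] | ].
  - by constructor 1.
  - by constructor 2.
  by case/andP=> /orP[]/eqP-> ?; [constructor 3 | constructor 4].
case=> -[E Ej]; try case: Ej => Ej; subst; rewrite {4}/rot;
 (repeat (case: ifP => ?; try lia)); rewrite {3}/rot;
 (repeat (case: ifP => ?; try lia)); rewrite /unrot;
 (repeat (case: ifP => ?; try lia)); rewrite {2}/rot;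
 (repeat (case: ifP => ?; try lia)); rewrite /rot;
 (repeat (case: ifP => ?; try lia)); rewrite /supp4; move=> S2;
 congr pair; lia.
Qed.

End Turns.

(* Enough 3-cycles to spread: a fixes the last column and b the first one. *)
Definition bridge (T : finType) (k : nat) (G : {set {perm T}}) (e : crd -> T)
    (c : bool) : Prop :=
  exists A : {set T}, [/\ 2 < #|A|, tri G A,
    exists j, [/\ j < k, e (0, j) \in A & odd k -> odd j = c]
    & exists j, j < k /\ e (k, j) \in A].

Section LargePiece.
Variables (T : finType) (k : nat) (e : crd -> T) (a b : {perm T}).
Hypothesis k9 : 9 < k.
Hypothesis e_inj : {in cdom k &, injective e}.
Hypothesis acts_a : acts e (cdom k) a (rot k 0 0).
Hypothesis acts_b : acts e (cdom k) b (rot k 1 0).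

Lemma acts_shift4 (e' : crd -> T) (a' b' : {perm T}) :
  acts e' (cdom k) a' (rot k 0 0) -> acts e' (cdom k) b' (rot k 1 0) ->
  acts e' (cdom k) ((a' * b') ^+ 6) (shift4 k).
Proof.
move=> aa ab; apply: acts_eq (acts_exp 6 (acts_mul aa ab)) => -[i j] /andP[ik jk].
by rewrite -turn2_6 //; lia.
Qed.

Lemma acts_vshift4 : acts e (cdom k) ((b * a) ^+ 6) (vshift4 k).
Proof.
have hK := @half_turnK k.
have ab' : acts (e \o half_turn k) (cdom k) b (rot k 0 0).
  by apply: acts_eq (acts_reindex hK acts_b) => c dc; apply: half_turn_rot1.
have aa' : acts (e \o half_turn k) (cdom k) a (rot k 1 0).
  by apply: acts_eq (acts_reindex hK acts_a) => c dc; apply: half_turn_rot.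
have as' := acts_shift4 ab' aa'.
have := acts_reindex hK as'; case=> [sf so]; split=> [c dc | x /so[c dc ->]].
  have /= := sf c dc; have [dh ->] := hK _ dc; rewrite half_turn_shift4 // => -[dv ->].
  split=> //; have [dh' <-] := hK _ dv; rewrite /=; congr e.
  have [_ ->] := hK _ dh'. 
  by rewrite -half_turn_shift4 //.
by exists c; rewrite //= (hK c dc).2.
Qed.

Lemma bridge_large : bridge k <<[set a; b]>> e false.
Proof.
have aG : a \in <<[set a; b]>> by rewrite mem_gen ?inE ?eqxx.
have bG : b \in <<[set a; b]>> by rewrite mem_gen ?inE ?eqxx ?orbT.
pose q := ((a * b) ^+ 6)%g; pose v := ((b * a) ^+ 6)%g.
have aq : acts e (cdom k) q (shift4 k) by apply: acts_shift4.
have av : acts e (cdom k) v (vshift4 k) by apply: acts_vshift4.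
pose h := (q * v^-1 * q^-1 * v)%g.
have ah : acts e (cdom k) h (comm4 k).
  have aq' := acts_inv aq (unshift4K k9); have av' := acts_inv av (vunshift4K k9).
  exact: acts_mul (acts_mul (acts_mul aq av') aq') av.
pose w := (a * b * a^-1 * b * b)%g.
have aw := acts_mul (acts_mul (acts_mul (acts_mul acts_a acts_b)
  (acts_inv acts_a (@unrotK k))) acts_b) acts_b.
rewrite -/w in aw.
pose g := (h ^ w^-1)%g.
have hG : h \in <<[set a; b]>> by rewrite !(groupM, groupV, groupX).
have gG : g \in <<[set a; b]>> by rewrite groupJ // !(groupM, groupV).
have hsupp x : h x != x -> exists i j, [/\ i <= k, j < k, supp4 k (i, j) & x = e (i, j)].
  move=> hx; have [[i j] /andP[/= ik jk] xij] := ah.2 x hx.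
  exists i, j; split=> //; apply: contraNT hx => N.
  by rewrite xij (ah.1 (i, j) _).2 ?comm4_out // /cdom /= ik.
have dom0 : cdom k (0, 0) by rewrite /cdom /=; lia.
have e0 : h (e (0, 0)) = e (k, 3).
  rewrite (ah.1 _ dom0).2; congr e; rewrite /comm4 /shift4 /vunshift4 /unshift4 /vshift4.
  by repeat (case: ifP => /= ?; try lia); congr pair; lia.
have we0 : w (e (0, 0)) = e (0, 0).
  rewrite (aw.1 _ dom0).2; congr e; rewrite /= /rot /unrot.
  by repeat (case: ifP => /= ?; try lia); congr pair; lia.
have gE x : g x = w^-1%g (h (w x)) by rewrite /g /conjg invgK !permM.
have e0k : e (0, 0) != e (k, 3).
  have dk3 : cdom k (k, 3) by rewrite /cdom /=; lia.
  by rewrite (inj_in_eq e_inj) // xpair_eqE andbF.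
have h0 : h (e (0, 0)) != e (0, 0) by rewrite e0 eq_sym.
have g0 : g (e (0, 0)) != e (0, 0).
  by rewrite gE we0 e0 -(inj_eq (@perm_inj _ w)) permKV we0 eq_sym.
have gh t : h t != t -> g t != t -> t = e (0, 0).
  case/hsupp=> i [j [ik jk sij ->]] gt.
  have hw : h (w (e (i, j))) != w (e (i, j)).
    by apply: contraNneq gt => hw; rewrite gE hw permK.
  have dij : cdom k (i, j) by rewrite /cdom /= ik.
  have [i' [j' [ik' jk' sij' E]]] := hsupp _ hw.
  congr e; apply: (supp4_conj k9 ik jk sij).
  have [dw ew] := aw.1 _ dij.
  have dij' : cdom k (i', j') by rewrite /cdom /= ik'.
  rewrite ew in E; move: sij'; rewrite -(e_inj dw dij' E); exact: id.
have [tA A3] := tri_comm hG gG h0 g0 gh.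
exists [set e (0, 0); g (e (0, 0)); h (e (0, 0))]; split=> //.
  by exists 0; split; rewrite ?inE ?eqxx //; lia.
by exists 3; rewrite e0 !inE eqxx !orbT; split=> //; lia.
Qed.

End LargePiece.

Definition memo (pts : seq crd) (f : crd -> crd) : crd -> crd :=
  let t := map f pts in fun c => nth c t (index c pts).

(* The permutation word^(product of fac), tabulated on pts. *)
Definition run (k : nat) (pts corners : seq crd) (word fac : seq nat) : crd -> crd :=
  foldl (fun f n => memo pts (iter n f))
    (memo pts (fun c => foldl (fun d i =>
       let p := nth (0, 0) corners i in rot k p.1 p.2 d) c word)) fac.

Definition bridge_check (k : nat) (pts : seq crd) (f : crd -> crd)
    (u v : nat) (c : bool) : bool :=
  let p := head (0, 0) [seq d <- pts | f d != d] in
  let q := f p in let r := f q in let s := [:: p; q; r] in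
  [&& all [in pts] s, uniq s, f r == p,
      all (fun d => (d \in s) || (f d == d)) pts,
      has (fun d => [&& d.1 == u, v <= d.2 < v + k & odd k ==> (odd (d.2 - v) == c)]) s
    & has (fun d => (d.1 == u + k) && (v <= d.2 < v + k)) s].

Section Certificates.
Variables (T : finType) (e : crd -> T) (pts : seq crd).
Local Notation acts := (acts e [in pts]).

Lemma acts_memo s f : acts s f -> acts s (memo pts f).
Proof.
apply: acts_eq => c dc; rewrite /memo (nth_map c) ?index_mem //.
by rewrite nth_index.
Qed.

Lemma acts_run (G : {group {perm T}}) k corners word fac :
    all (fun i => i < size corners) word ->
    (forall p, p \in corners -> exists2 s, s \in G & acts s (rot k p.1 p.2)) ->
  exists2 s, s \in G & acts s (run k pts corners word fac).
Proof.
move=> wc Gc; rewrite /run; set g := fun c => foldl _ c word.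
have [s sG sg] : exists2 s, s \in G & acts s g.
  rewrite {}/g; elim: word wc => [_ | i word IHw /= /andP[ic /IHw[s sG sf]]].
    by exists 1%g; [apply: group1 | apply: acts1].
  have [t tG tf] := Gc _ (mem_nth (0, 0) ic).
  by exists (t * s)%g; [apply: groupM | apply: acts_mul tf sf].
have: exists2 s, s \in G & acts s (memo pts g) by exists s; last exact: acts_memo.
elim: fac (memo pts g) => //= n fac IHf f [t tG tf]; apply: IHf.
by exists (t ^+ n)%g; [apply: groupX | apply/acts_memo/acts_exp].
Qed.

Hypothesis e_inj : {in [in pts] &, injective e}.

Lemma bridge_cert (G : {group {perm T}}) k corners word fac u v c :
    all (fun i => i < size corners) word ->
    (forall p, p \in corners -> exists2 s, s \in G & acts s (rot k p.1 p.2)) ->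
    bridge_check k pts (run k pts corners word fac) u v c ->
  bridge k G (fun d => e (u + d.1, v + d.2)) c.
Proof.
move=> wc Gc; have [s sG] := acts_run fac wc Gc; set f := run _ _ _ _ _ => sf.
rewrite /bridge_check; set p := head _ _; set q := f p; set r := f q.
case/and5P=> /and4P[dp dq dr _] upqr /eqP frp /allP fo.
case/andP=> /hasP[[x y] xys xy0] /hasP[[x' y'] xys' /andP[/eqP/= xu' /= vy']].
case/and3P: xy0 => /eqP/= xu /= vy yc.
have sE : s = cycle3 (e p) (e q) (e r).
  apply: (acts_cycle3 e_inj sf) => // d dd; have /orP[-> // | /eqP] := fo d dd.
  by [].
move: (upqr); rewrite /= !inE negb_or andbT => /andP[/andP[npq npr] nqr].
exists [set e p; e q; e r]; split.
- rewrite -setUA cardsU1 cards2 !inE negb_or.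
  by rewrite !(inj_in_eq e_inj) ?npq ?npr ?nqr.
- by apply: tri_cycle3; rewrite ?(inj_in_eq e_inj) // -sE.
- exists (y - v); split; first by move: vy; clear; lia.
    rewrite /= addn0 subnKC -?xu; last by case/andP: vy.
    by move: xys; rewrite !inE => /or3P[]/eqP->; rewrite eqxx ?orbT.
  by move=> ok; rewrite ok in yc; apply/eqP.
exists (y' - v); split; first by move: vy'; clear; lia.
rewrite /= -xu' subnKC; last by case/andP: vy'.
by move: xys'; rewrite !inE => /or3P[]/eqP->; rewrite eqxx ?orbT.
Qed.

End Certificates.

Definition box (w h u v : nat) : seq crd :=
  [seq (u + i, v + j) | i <- iota 0 w, j <- iota 0 h].

Lemma mem_box w h u v c :
  (c \in box w h u v) = (u <= c.1 < u + w) && (v <= c.2 < v + h).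
Proof.
case: c => x y /=; apply/allpairsP/andP => [[[i j] /= []] | [xu yv]].
  by rewrite !mem_iota => ? ? [-> ->]; lia.
by exists (x - u, y - v); rewrite !mem_iota; split=> /=; [lia | lia | congr pair; lia].
Qed.

Lemma cdom_box k c : cdom k c = (c \in box k.+1 k 0 0).
Proof. by rewrite mem_box /cdom !add0n ltnS. Qed.

(* Words in the two turns 0, 1 found by computer search, with the exponent that
   kills all their cycles but one 3-cycle. *)
Definition piece_cert (k : nat) : seq nat * seq nat :=
  match k with
  | 4 => ([:: 0; 1; 1; 0; 0; 1; 0; 1; 1; 1; 0; 0; 0; 1], [:: 2; 2])
  | 5 => ([:: 1; 0; 0; 0; 1; 0; 0; 1; 1; 1; 0; 0; 0; 1; 0; 0], [:: 2; 5])
  | 6 => ([:: 1; 1; 1; 0; 0; 1; 1; 1; 0; 1; 1; 0; 1; 1; 1; 0; 1; 1; 1; 0; 1; 1; 1],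
          [:: 2; 2; 5])
  | 7 => ([:: 1; 0; 0; 0; 1; 1; 1; 0; 0; 1; 0; 0; 0; 1; 0; 0; 1; 1; 1; 0; 0; 1; 1; 1],
          [:: 2; 5; 7])
  | 8 => ([:: 1; 0; 1; 1; 0; 0; 0; 1; 0; 0; 1; 1; 1; 0; 0; 0; 1; 1], [:: 2; 5; 7])
  | _ => ([:: 0; 0; 0; 1; 1; 1; 0; 0; 0; 1; 1; 0; 0; 0; 1; 1], [:: 2; 2; 2; 5; 7])
  end.

Lemma piece_certP k : 3 < k < 10 ->
  let: (w, fac) := piece_cert k in
  bridge_check k (box k.+1 k 0 0)
    (run k (box k.+1 k 0 0) [:: (0, 0); (1, 0)] w fac) 0 0 false
  && all (fun i => i < 2) w.
Proof.
do 4![case: k => // k]; do 6![case: k => [|k]; first by vm_compute].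
by [].
Qed.

Section SmallPiece.
Variables (T : finType) (k : nat) (e : crd -> T) (a b : {perm T}).
Hypothesis k3 : 3 < k.
Hypothesis e_inj : {in cdom k &, injective e}.
Hypothesis acts_a : acts e (cdom k) a (rot k 0 0).
Hypothesis acts_b : acts e (cdom k) b (rot k 1 0).

Lemma bridge_piece : bridge k <<[set a; b]>> e false.
Proof.
have [k9 | k9] := ltnP 9 k; first exact: bridge_large.
have := @piece_certP k; case: (piece_cert k) => w fac.
rewrite k3 ltnS k9 => /(_ isT)/andP[chk wc].
have E s f : acts e (cdom k) s f -> acts e [in box k.+1 k 0 0] s f.
  case=> sf so; split=> [c | x /so[c dc ->]].
    by rewrite -cdom_box => /sf; rewrite -cdom_box.
  by exists c; rewrite // -cdom_box.
have inj : {in [in box k.+1 k 0 0] &, injective e}.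
  move=> c d dc dd; have [dc' dd'] : cdom k c /\ cdom k d by rewrite !cdom_box.
  exact: e_inj.
have [|A [A3 tA [j [jk ej cj]] [j' [jk' ej']]]] :=
    bridge_cert (G := <<[set a; b]>>) (corners := [:: (0, 0); (1, 0)]) inj wc _ chk.
  move=> p; rewrite !inE => /orP[]/eqP->.
    by exists a; [rewrite mem_gen ?inE ?eqxx | apply: E].
  by exists b; [rewrite mem_gen ?inE ?eqxx ?orbT | apply: E].
by exists A; split=> //; [exists j | exists j'].
Qed.

End SmallPiece.

(** * Figures *)

Lemma tri_bridge (T : finType) (k : nat) (e : crd -> T) (G : {group {perm T}})
    (a b : {perm T}) (c : bool) : 1 < k ->
    acts e (cdom k) a (rot k 0 0) -> acts e (cdom k) b (rot k 1 0) ->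
    a \in G -> b \in G -> bridge k G e c ->
  exists D : {set T}, [/\ 2 < #|D|, tri G D &
    forall i j, i <= k -> j < k -> (odd k -> odd (i + j) = c) -> e (i, j) \in D].
Proof.
move=> k1 aa ab aG bG [A [A3 tA [j [jk ej cj]] [j' [jk' ej']]]].
have HG : [set a; b] \subset G.
  by apply/subsetP=> s; rewrite !inE => /orP[]/eqP->.
have [|D [sAD tD Dst]] := tri_spread A3 tA HG.
  move=> h; rewrite !inE => /orP[]/eqP->.
    exists (e (k, j')) => //; rewrite (aa.1 (k, j') _).2 /=.
      by rewrite add0n ltnn.
    by rewrite /cdom /= leqnn.
  by exists (e (0, j)) => //; rewrite (ab.1 (0, j) _).2.
exists D; split=> //; first exact: leq_trans A3 (subset_leq_card sAD).
move=> x y xk yk xyc.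
have [|||g gH <-] := link_piece k1 aa ab (c := (0, j)) (d := (x, y)).
- by rewrite /cdom /= jk.
- by rewrite /cdom /= xk.
- by move=> ok /=; rewrite xyc // cj.
exact: Dst (subsetP sAD _ ej) gH.
Qed.

Lemma tri_piece (T : finType) (k : nat) (e : crd -> T) (G : {group {perm T}})
    (a b : {perm T}) (c : bool) : 3 < k -> {in cdom k &, injective e} ->
    acts e (cdom k) a (rot k 0 0) -> acts e (cdom k) b (rot k 1 0) ->
    a \in G -> b \in G ->
  exists D : {set T}, [/\ 2 < #|D|, tri G D &
    forall i j, i <= k -> j < k -> (odd k -> odd (i + j) = c) -> e (i, j) \in D].
Proof.
move=> k3 e_inj aa ab aG bG.
wlog cF : c / c = false \/ odd k.
  have [ok | ek] := boolP (odd k); first by apply; right.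
  case/(_ false); first by left.
  by move=> D [D3 tD eD]; exists D; split=> // i j ik jk _; apply: eD.
have bG' a' b' : a' \in G -> b' \in G -> <<[set a'; b']>> \subset G.
  by move=> ? ?; rewrite gen_subG; apply/subsetP=> s; rewrite !inE => /orP[]/eqP->.
have bS a' b' e' d : a' \in G -> b' \in G ->
    bridge k <<[set a'; b']>> e' d -> bridge k G e' d.
  move=> a'G b'G [A [A3 tA A0 Ak]]; exists A; split=> // x y z xA yA zA xy yz xz.
  by apply: (subsetP (bG' a' b' _ _)) => //; apply: tA.
have k1 : 1 < k by lia.
case: c cF => [[// | ok] | _]; last first.
  exact: tri_bridge k1 aa ab aG bG (bS _ _ _ _ aG bG (bridge_piece k3 e_inj aa ab)).
have mK := @mirrorK k.
have aV : acts (e \o mirror k) (cdom k) b^-1 (rot k 0 0).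
  apply: acts_eq (acts_reindex mK (acts_inv ab (@unrot1K k))) => d dd.
  exact: mirror_unrot1.
have bV : acts (e \o mirror k) (cdom k) a^-1 (rot k 1 0).
  apply: acts_eq (acts_reindex mK (acts_inv aa (@unrotK k))) => d dd.
  exact: mirror_unrot.
have aVG : a^-1%g \in G by rewrite groupV.
have bVG : b^-1%g \in G by rewrite groupV.
have inj' := inj_reindex mK e_inj.
have [D [D3 tD eD]] := tri_bridge k1 aV bV bVG aVG
  (bS _ _ _ _ bVG aVG (bridge_piece k3 inj' aV bV)).
exists D; split=> // i j ik jk /(_ ok) ij.
have -> : (i, j) = mirror k (k - i, j) by rewrite /mirror /= subKn.
by apply: eD => // [|_]; [apply: leq_subr | lia].
Qed.

Section Place.
Local Open Scope ring_scope.

(* Coordinates around p; with tau they are transposed, so that vertical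
   rectangles become horizontal ones and clockwise turns become inverses. *)
Definition place (tau : bool) (p : tile) (c : crd) : tile :=
  if tau then (p.1 + c.2%:Z, p.2 + c.1%:Z) else (p.1 + c.1%:Z, p.2 + c.2%:Z).

Lemma place_inj tau p : injective (place tau p).
Proof.
by move=> [x y] [x' y']; rewrite /place; case: tau => -[] /= ? ?; congr pair; lia.
Qed.

Lemma in_rect w h p t :
  (t \in rect w h p) = (p.1 <= t.1 < p.1 + w%:Z) && (p.2 <= t.2 < p.2 + h%:Z).
Proof.
case: t p => x y [px py] /=; apply/imfset2P/idP => /= [[i _ [j _ [-> ->]]] |].
  by have := ltn_ord i; have := ltn_ord j; lia.
move=> h0; have iw : (`|x - px| < w)%N by lia.
have jh : (`|y - py| < h)%N by lia.
exists (Ordinal iw) => //; exists (Ordinal jh) => //=.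
by congr pair; lia.
Qed.

Lemma turn_in k p t : t \in block k p -> turn k p t \in block k p.
Proof.
by move=> tb; rewrite /turn tb; move: tb; rewrite !in_rect /=; lia.
Qed.

Lemma turn_inj k p : injective (turn k p).
Proof.
move=> s t; rewrite /turn; case: ifP => sb; case: ifP => tb //.
- case: s t {sb tb} => sx sy [tx ty] [] /= ? ?; congr pair; lia.
- by move=> E; move: tb; rewrite -E; have := turn_in sb; rewrite /turn sb => ->.
- by move=> E; move: sb; rewrite E; have := turn_in tb; rewrite /turn tb => ->.
Qed.

Section Figure.
Variables (k : nat) (F : figure).

Lemma move_exists p : (0 < k)%N -> (block k p `<=` F)%fset ->
  exists2 s, s \in moves k F & forall t : F, val (s t) = turn k p (val t).
Proof.
move=> k0 bF; have /fsubsetP bF' := bF.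
have tF (t : F) : turn k p (val t) \in F.
  have [tb | tb] := boolP (val t \in block k p); first by apply/bF'/turn_in.
  by rewrite /turn (negPf tb); apply: valP.
have inj : injective (fun t : F => [` tF t]%fset).
  by move=> s t /(congr1 val) /= /turn_inj/val_inj.
exists (perm inj) => [|t]; last by rewrite permE.
have pF : p \in F by apply: bF'; rewrite in_rect; case: (p) => x y /=; lia.
rewrite inE; apply/existsP; exists [` pF]%fset.
by rewrite bF; apply/forallP=> t; rewrite permE.
Qed.

Lemma movesP s : s \in moves k F ->
  exists2 p, (block k p `<=` F)%fset & forall t : F, val (s t) = turn k p (val t).
Proof.
rewrite inE => /existsP[p /andP[bF /forallP st]].
by exists (val p) => // t; apply/eqP.
Qed.

Definition chart (t0 : F) (tau : bool) (p : tile) (c : crd) : F :=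
  insubd t0 (place tau p c).

Lemma chart_val t0 tau p c : place tau p c \in F ->
  val (chart t0 tau p c) = place tau p c.
Proof. exact: insubdK. Qed.

Lemma chart_inj t0 tau p (dom : pred crd) :
  (forall c, dom c -> place tau p c \in F) ->
  {in dom &, injective (chart t0 tau p)}.
Proof.
move=> dF c d dc dd /(congr1 val); rewrite !chart_val; [|exact: dF..].
exact: place_inj.
Qed.

Lemma place_block tau p u v c :
  (place tau p c \in block k (place tau p (u, v)))
  = (u <= c.1 < u + k)%N && (v <= c.2 < v + k)%N.
Proof. by case: c => x y; rewrite in_rect /place; case: tau => /=; lia. Qed.

Lemma turn_place tau p u v c :
  turn k (place tau p (u, v)) (place tau p (if tau then rot k u v c else c))
  = place tau p (if tau then c else rot k u v c).
Proof.
rewrite /turn place_block; case: p c => px py [x y]; rewrite /rot /place.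
have [xy | /negPf xy] := boolP [&& u <= x, x < u + k, v <= y & y < v + k]%N.
  by case: tau => /=; (rewrite ifT /=; [congr pair; lia | lia]).
by case: tau => /=; rewrite ifF //=; lia.
Qed.

Lemma chart_acts t0 tau p u v (dom : pred crd) : (0 < k)%N ->
    (forall c, dom c -> place tau p c \in F) ->
    (forall x y, u <= x < u + k -> v <= y < v + k -> dom (x, y))%N ->
  exists2 s, s \in puzzle_group k F & acts (chart t0 tau p) dom s (rot k u v).
Proof.
move=> k0 dF bD; set q := place tau p (u, v).
have bE t : t \in block k q -> exists2 c, dom c & t = place tau p c.
  rewrite in_rect => tq.
  pose c := if tau then (absz (t.2 - p.2), absz (t.1 - p.1))
            else (absz (t.1 - p.1), absz (t.2 - p.2)).
  exists c; first by move: tq; rewrite /c /q /place; case: (tau) => /= tq; apply: bD; lia.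
  case: t tq @c => tx ty; rewrite /q /place; case: (tau) => /= tq; congr pair; lia.
have bF : (block k q `<=` F)%fset by apply/fsubsetP=> t /bE[c /dF ? ->].
have rD c : dom c -> dom (rot k u v c).
  case: c => x y dc; rewrite /rot; case: ifP => // xy; apply: bD; lia.
have [s /(mem_gen (A := moves k F)) sG st] := move_exists k0 bF.
have sE c : dom c -> s (chart t0 tau p (if tau then rot k u v c else c))
                   = chart t0 tau p (if tau then c else rot k u v c).
  move=> dc; apply: val_inj; rewrite st !chart_val ?turn_place //.
    by apply: dF; case: (tau) => //; apply: rD.
  by apply: dF; case: (tau) => //; apply: rD.
have so x : s x != x -> exists2 c, dom c & x = chart t0 tau p c.
  rewrite -val_eqE st /turn; case: ifP => [/bE[c dc xc] _ | _]; last by rewrite eqxx.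
  by exists c => //; apply: val_inj; rewrite chart_val //; apply: dF.
case: (tau) sE so => sE so; last first.
  by exists s => //; split=> // c dc; split; [apply: rD | apply: sE].
exists s^-1%g; first by rewrite groupV.
split=> [c dc | x sx].
  by split; [apply: rD | apply: (@perm_inj _ s); rewrite permKV sE].
by apply: so; apply: contraNneq sx => {1}<-; rewrite permK.
Qed.

End Figure.
End Place.

(* Two overlapping pieces R1, R2 for k = 2, 3, in coordinates: R1 is the
   (k+1) x k box of corner (k+1, k+1), R2 the box of corner (u, v), upright if
   tall. An entry (word, fac, l) says that for all (tall, u, v, c) in l the
   permutation word^(product of fac) of R1 :|: R2 is a 3-cycle of colour c
   joining the first and last columns of R1; the letters 0, 1 are the turns
   of R1 and 2, 3 those of R2. *)
Definition pair_cert := (seq nat * seq nat * seq (bool * nat * nat * bool))%type.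

Definition pair_certs2 : seq pair_cert :=
  [:: ([:: 1; 3; 1; 2; 0; 1; 0; 0], [:: 7],
      [:: (false, 1, 2, false); (false, 1, 4, false); (false, 2, 4, false);
          (false, 4, 2, false); (false, 5, 2, false); (false, 5, 4, false);
          (true, 2, 1, false); (true, 2, 2, false); (true, 2, 3, false);
          (true, 2, 4, false); (true, 5, 1, false); (true, 5, 2, false);
          (true, 5, 4, false)]);
      ([:: 2; 1; 0; 1; 0], [:: 2; 2],
      [:: (false, 2, 3, false); (false, 3, 4, false); (false, 4, 4, false);
          (false, 5, 3, false); (true, 3, 4, false); (true, 4, 4, false);
          (true, 5, 3, false)]);
      ([:: 1; 3; 0; 1; 0], [:: 2; 2],
      [:: (false, 1, 3, false); (false, 2, 2, false); (false, 3, 2, false);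
          (false, 4, 3, false); (true, 3, 1, false); (true, 4, 1, false)]);
      ([:: 3; 0; 0; 2; 2; 1; 1; 3], [:: 2],
      [:: (true, 3, 2, false); (true, 3, 3, false); (true, 4, 2, false);
          (true, 4, 3, false)])].

Definition pair_certs3 : seq pair_cert :=
  [:: ([:: 1; 0; 3; 2; 3; 2; 1; 0], [:: 2],
      [:: (false, 2, 2, false); (false, 2, 5, true); (false, 2, 6, true);
          (false, 3, 2, false); (false, 3, 5, false); (false, 3, 6, false);
          (false, 5, 2, true); (false, 5, 5, true); (false, 5, 6, true);
          (false, 6, 2, true); (false, 6, 5, false); (false, 6, 6, false);
          (true, 2, 4, false); (true, 3, 1, false); (true, 3, 4, false);
          (true, 4, 1, false); (true, 5, 1, true); (true, 6, 1, true)]);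
      ([:: 2; 2; 0; 1; 0; 1; 0; 0], [:: 2; 2],
      [:: (false, 3, 2, true); (false, 3, 3, false); (false, 4, 2, true);
          (false, 4, 6, true); (false, 5, 2, false); (false, 6, 6, true);
          (false, 7, 5, true); (true, 3, 2, true); (true, 3, 3, false);
          (true, 3, 5, false); (true, 4, 2, true); (true, 4, 6, true);
          (true, 5, 2, false); (true, 6, 6, true); (true, 7, 5, true)]);
      ([:: 1; 0; 1; 0; 1; 1; 3; 3], [:: 2; 2],
      [:: (false, 1, 3, false); (false, 3, 6, true); (false, 4, 2, false);
          (false, 4, 6, false); (false, 5, 3, true); (false, 5, 6, false);
          (true, 2, 2, false); (true, 4, 5, true); (true, 5, 1, false);
          (true, 5, 5, false); (true, 6, 2, true); (true, 6, 4, true);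
          (true, 6, 5, false)]);
      ([:: 2; 0; 2; 1; 1; 1; 0; 2; 2; 0; 1], [:: 2; 2; 2],
      [:: (false, 2, 2, true); (false, 2, 3, true); (false, 2, 4, true);
          (false, 6, 3, true); (false, 6, 5, true); (true, 2, 2, true);
          (true, 2, 3, true); (true, 2, 4, true); (true, 2, 5, true);
          (true, 6, 3, true); (true, 6, 5, true)]);
      ([:: 0; 1; 2; 2; 0; 0], [:: 2; 2; 5],
      [:: (false, 5, 3, false); (false, 6, 2, false); (false, 6, 4, false);
          (false, 7, 3, false); (false, 7, 5, false); (true, 5, 3, false);
          (true, 6, 2, false); (true, 6, 4, false); (true, 7, 3, false);
          (true, 7, 5, false)]);
      ([:: 0; 2; 2; 3; 3; 1; 0; 1], [:: 2; 2; 5],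
      [:: (false, 1, 5, false); (false, 3, 5, true); (false, 5, 4, false);
          (false, 7, 3, true); (true, 3, 6, false); (true, 4, 3, true);
          (true, 4, 4, true); (true, 6, 3, false)]);
      ([:: 0; 1; 3; 0; 0; 3], [:: 2; 2; 5],
      [:: (false, 4, 3, false); (false, 4, 5, false); (false, 6, 3, false);
          (true, 5, 4, false); (true, 7, 2, false); (true, 7, 4, false)]);
      ([:: 0; 0; 3; 3; 0; 1; 0; 1], [:: 2; 2],
      [:: (false, 2, 3, false); (false, 2, 5, false); (true, 3, 1, true);
          (true, 3, 2, false); (true, 4, 1, true); (true, 7, 4, true)]);
      ([:: 3; 1; 0; 0; 3], [:: 2; 2; 2],
      [:: (false, 4, 3, true); (false, 4, 5, true); (false, 5, 4, true);
          (true, 5, 2, true); (true, 5, 4, true)]);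
      ([:: 1; 1; 0; 3; 2; 3; 2; 1], [:: 2; 2; 5],
      [:: (false, 1, 3, true); (false, 1, 5, true); (true, 3, 3, true);
          (true, 3, 5, true); (true, 3, 6, true)]);
      ([:: 1; 3; 3; 0; 1; 0], [:: 2],
      [:: (false, 2, 6, false); (true, 2, 5, false); (true, 3, 4, true);
          (true, 4, 5, false)]);
      ([:: 1; 0; 0; 3; 1; 1; 0], [:: 2; 2; 2],
      [:: (false, 1, 4, false); (false, 6, 4, true); (true, 2, 3, false);
          (true, 7, 3, true)]);
      ([:: 1; 1; 0; 0; 3; 1; 2; 0; 0; 1; 1], [:: 2; 2; 2],
      [:: (false, 3, 4, false); (false, 5, 5, false); (true, 4, 3, false);
          (true, 4, 4, false)]);
      ([:: 3; 1; 0; 2; 3; 1; 2], [:: 2; 2; 2],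
      [:: (false, 7, 4, true); (true, 5, 6, true); (true, 7, 2, true)]);
      ([:: 1; 0; 1; 0; 2; 0; 0; 2; 0], [:: 2; 2; 5],
      [:: (false, 2, 4, false); (true, 4, 2, false); (true, 4, 6, false)]);
      ([:: 1; 0; 2; 3; 2; 3; 0; 1; 0; 0], [:: 2; 2],
      [:: (true, 5, 6, false); (true, 6, 1, false); (true, 6, 6, false)]);
      ([:: 0; 1; 2; 2; 1], [:: 2; 2],
      [:: (true, 5, 3, true); (true, 5, 5, true)]);
      ([:: 1; 2; 1; 2; 0; 1; 3; 3], [:: 2; 2],
      [:: (false, 1, 4, true); (false, 3, 4, true)]);
      ([:: 3; 1; 1; 0], [:: 5; 7],
      [:: (false, 3, 3, true)]);
      ([:: 1; 2; 2; 3; 2; 0; 1], [:: 2; 5],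
      [:: (false, 7, 4, false)])].

Definition pair_corners (k : nat) (tall : bool) (u v : nat) : seq crd :=
  [:: (k.+1, k.+1); (k.+2, k.+1); (u, v); if tall then (u, v.+1) else (u.+1, v)].

Definition pair_pts (k : nat) (tall : bool) (u v : nat) : seq crd :=
  box k.+1 k k.+1 k.+1 ++ (if tall then box k k.+1 u v else box k.+1 k u v).

Definition pair_check (k : nat) (x : pair_cert) : bool :=
  let: (word, fac, l) := x in
  all (fun i => i < 4) word &&
  all (fun y => let: (tall, u, v, c) := y in
    bridge_check k (pair_pts k tall u v)
      (run k (pair_pts k tall u v) (pair_corners k tall u v) word fac)
      k.+1 k.+1 c) l.

Lemma pair_check2 : all (pair_check 2) pair_certs2.
Proof. by vm_compute. Qed.

Lemma pair_check3 : all (pair_check 3) pair_certs3.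
Proof. by vm_compute. Qed.

(* The pieces overlap, in two adjacent tiles for k odd, and are distinct. *)
Definition pair_ok (k : nat) (tall : bool) (u v : nat) : bool :=
  let w := k + ~~ tall in let h := k + tall in
  [&& u < k.+1 + k.+1, k.+1 < u + w, v < k.+1 + k, k.+1 < v + h,
      odd k ==> [&& u.+1 < k.+1 + k.+1 & k.+2 < u + w]
                || [&& v.+1 < k.+1 + k & k.+2 < v + h]
    & tall || ((u, v) != (k.+1, k.+1))].

Definition pair_covered (k : nat) (l : seq (bool * nat * nat * bool)) : bool :=
  all (fun tall => all (fun u => all (fun v => pair_ok k tall u v ==>
      all (fun c => (tall, u, v, odd k && c) \in l) [:: true; false])
    (iota 0 (k.+1 + k))) (iota 0 (k.+1 + k.+1))) [:: true; false].

Lemma pair_covered2 : pair_covered 2 (flatten (map snd pair_certs2)).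
Proof. by vm_compute. Qed.

Lemma pair_covered3 : pair_covered 3 (flatten (map snd pair_certs3)).
Proof. by vm_compute. Qed.

Lemma pair_cert_exists k tall u v c : 1 < k < 4 -> pair_ok k tall u v ->
  exists word fac, all (fun i => i < 4) word /\
    bridge_check k (pair_pts k tall u v)
      (run k (pair_pts k tall u v) (pair_corners k tall u v) word fac)
      k.+1 k.+1 (odd k && c).
Proof.
have main l : all (pair_check k) l -> pair_covered k (flatten (map snd l)) ->
    pair_ok k tall u v -> exists word fac, all (fun i => i < 4) word /\
    bridge_check k (pair_pts k tall u v)
      (run k (pair_pts k tall u v) (pair_corners k tall u v) word fac)
      k.+1 k.+1 (odd k && c).
  move=> chk cov ok; have ul : u \in iota 0 (k.+1 + k.+1).
    by rewrite mem_iota; case/and5P: ok.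
  have vl : v \in iota 0 (k.+1 + k) by rewrite mem_iota; case/and5P: ok.
  have tl : tall \in [:: true; false] by case: (tall).
  have cl : c \in [:: true; false] by case: (c).
  have /flatten_mapP[[[word fac] y] yl my] :
      (tall, u, v, odd k && c) \in flatten (map snd l).
    move/allP/(_ tall tl)/allP/(_ u ul)/allP/(_ v vl): cov.
    by rewrite ok => /allP/(_ c cl).
  exists word, fac; have /andP[wl /allP/(_ _ my)] := allP chk _ yl.
  by split.
case: k main => [|[|[|[|k]]]] // main _.
  exact: main pair_check2 pair_covered2.
exact: main pair_check3 pair_covered3.
Qed.

Section Spanned.
Local Open Scope ring_scope.
Variables (k : nat) (E : figure).
Local Notation G := (puzzle_group k E).

Definition hue (c : bool) (t : tile) : bool :=
  odd k ==> (odd (absz (t.1 + t.2)) == c).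

Definition part (F : figure) (c : bool) : {set E} :=
  [set t : E | (val t \in F) && hue c (val t)].

Definition spanned (F : figure) (c : bool) : Prop :=
  exists D : {set E}, [/\ (2 < #|D|)%N, tri G D & part F c \subset D].

Lemma partU F1 F2 c : part (F1 `|` F2)%fset c = part F1 c :|: part F2 c.
Proof. by apply/setP=> t; rewrite !inE andb_orl. Qed.

Lemma piece_place R : is_piece k R -> exists tau p,
  forall t, t \in R <-> exists2 c, cdom k c & t = place tau p c.
Proof.
case=> p [] ->; [exists true, p | exists false, p] => -[x y]; rewrite in_rect.
  split=> [/= h | [[i j] /andP[/= ik jk] [-> ->]] /=]; last by lia.
  exists (absz (y - p.2), absz (x - p.1)); first by rewrite /cdom /=; lia.
  by rewrite /place /=; congr pair; lia.
split=> [/= h | [[i j] /andP[/= ik jk] [-> ->]] /=]; last by lia.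
exists (absz (x - p.1), absz (y - p.2)); first by rewrite /cdom /=; lia.
by rewrite /place /=; congr pair; lia.
Qed.

Lemma hue_place tau p c i j : odd k ->
  hue c (place tau p (i, j)) = (odd (i + j) == c (+) odd (absz (p.1 + p.2))).
Proof.
move=> ok; rewrite /hue ok /place.
have -> : odd (absz ((if tau then (p.1 + (i, j).2%:Z, p.2 + (i, j).1%:Z)
    else (p.1 + (i, j).1%:Z, p.2 + (i, j).2%:Z)).1 + (if tau then
    (p.1 + (i, j).2%:Z, p.2 + (i, j).1%:Z)
    else (p.1 + (i, j).1%:Z, p.2 + (i, j).2%:Z)).2)) = odd (i + j) (+) odd (absz (p.1 + p.2)).
  by case: tau => /=; lia.
by case: c; case: odd; case: odd.
Qed.

Hypothesis k1 : (1 < k)%N.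

Lemma piece_chart R : is_piece k R -> (R `<=` E)%fset ->
  exists tau p (e : crd -> E), exists2 a, a \in G & exists2 b, b \in G &
  [/\ acts e (cdom k) a (rot k 0 0), acts e (cdom k) b (rot k 1 0),
      forall c, cdom k c -> val (e c) = place tau p c
    & forall t, (val t \in R) <-> exists2 c, cdom k c & t = e c].
Proof.
move=> pR /fsubsetP RE; have [tau [p tR]] := piece_place pR.
have dE c : cdom k c -> place tau p c \in E by move=> dc; apply/RE/tR; exists c.
have t0 : E by exists (place tau p (0, 0)%N); apply: dE; rewrite /cdom /=; lia.
have k0 : (0 < k)%N by lia.
have [|a aG aa] := @chart_acts k E t0 tau p 0 0 (cdom k) k0 dE.
  by move=> x y ? ?; rewrite /cdom /=; lia.
have [|b bG ab] := @chart_acts k E t0 tau p 1 0 (cdom k) k0 dE.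
  by move=> x y ? ?; rewrite /cdom /=; lia.
exists tau, p, (chart t0 tau p), a => //; exists b => //; split=> //.
  by move=> c dc; rewrite chart_val ?dE.
move=> t; rewrite tR; split=> -[c dc tc]; exists c => //.
  by apply: val_inj; rewrite chart_val ?dE.
by rewrite tc chart_val ?dE.
Qed.

Lemma place_chart_inj (e : crd -> E) tau p :
  (forall c, cdom k c -> val (e c) = place tau p c) -> {in cdom k &, injective e}.
Proof.
by move=> eE c d dc dd /(congr1 val); rewrite !eE //; apply: place_inj.
Qed.

Lemma piece_turns R : is_piece k R -> (R `<=` E)%fset ->
  exists e : crd -> E, exists2 a, a \in G & exists2 b, b \in G &
  [/\ acts e (cdom k) a (rot k 0 0), acts e (cdom k) b (rot k 1 0),
      {in cdom k &, injective e},
      forall t, (val t \in R) <-> exists2 c, cdom k c & t = e c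
    & forall c, exists d : bool, forall i j, (i <= k)%N -> (j < k)%N ->
      hue c (val (e (i, j))) = (odd k ==> (odd (i + j) == d))].
Proof.
move=> pR RE; have [tau [p [e [a aG [b bG [aa ab eE eR]]]]]] := piece_chart pR RE.
exists e, a => //; exists b => //; split=> //; first exact: place_chart_inj eE.
move=> c; exists (c (+) odd (absz (p.1 + p.2))) => i j ik jk.
rewrite eE; last by rewrite /cdom /= ik.
have [ok | ek] := boolP (odd k); first by rewrite hue_place.
by rewrite /hue (negPf ek).
Qed.

Lemma spanned_large R c : (3 < k)%N -> is_piece k R -> (R `<=` E)%fset ->
  spanned R c.
Proof.
move=> k3 pR RE; have [e [a aG [b bG [aa ab inj tR ec]]]] := piece_turns pR RE.
have [d ecd] := ec c.
have [D [D3 tD eD]] := tri_piece d k3 inj aa ab aG bG.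
exists D; split=> //; apply/subsetP=> t; rewrite inE => /andP[/tR[[i j] /andP[/= ik jk] ->]].
by rewrite ecd // => /implyP ij; apply: eD => // /ij/eqP.
Qed.

Lemma spanned_merge (F1 F2 : figure) c (t : E) :
    val t \in F1 -> val t \in F2 -> hue c (val t) ->
  spanned F1 c -> spanned F2 c -> spanned (F1 `|` F2)%fset c.
Proof.
move=> t1 t2 tc [D1 [D13 tD1 /subsetP F1D]] [D2 [D23 tD2 /subsetP F2D]].
exists (D1 :|: D2); split.
- by apply: leq_trans D13 (subset_leq_card (subsetUl _ _)).
- by apply: (@tri_merge _ _ _ _ t) => //; [apply: F1D | apply: F2D]; rewrite inE ?t1 ?t2.
apply/subsetP=> s; rewrite partU !inE => /orP[] sc; apply/orP.
  by left; apply: F1D; rewrite inE.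
by right; apply: F2D; rewrite inE.
Qed.

Lemma spanned_spread (F R : figure) c (t : E) : val t \in F -> val t \in R -> hue c (val t) ->
    is_piece k R -> (R `<=` E)%fset -> ~~ (part F c \subset part R c) ->
  spanned F c -> spanned (F `|` R)%fset c.
Proof.
move=> tF tR tc pR RE /subsetPn[s sF sR] [D [D3 tD FD]].
have [e [a aG [b bG [aa ab inj eR ec]]]] := piece_turns pR RE.
have sR' : val s \notin R.
  by move: sF sR; rewrite !inE => /andP[_ ->]; rewrite andbT.
have fixs h f : acts e (cdom k) h f -> h s = s.
  move=> [_ ho]; apply/eqP; apply: contraNT sR' => /ho[d dd ->].
  by apply/eR; exists d.
have HG : [set a; b] \subset G.
  by apply/subsetP=> h; rewrite !inE => /orP[]/eqP->.
have [|D' [DD' tD' st]] := tri_spread D3 tD HG.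
  move=> h; rewrite !inE => /orP[]/eqP->; exists s; rewrite ?(subsetP FD) //.
    exact: fixs aa.
  exact: fixs ab.
exists D'; split=> //; first exact: leq_trans D3 (subset_leq_card DD').
rewrite partU subUset (subset_trans FD) //=; apply/subsetP=> r; rewrite inE.
case/andP=> /eR[[i j] dij ->]; have /andP[/= ik jk] := dij.
have /eR[[x y] dxy te] := tR; have /andP[/= xk yk] := dxy.
have [d ecd] := ec c; rewrite ecd // => ijd.
have := tc; rewrite te ecd // => xyd.
have [|g gH <-] := link_piece k1 aa ab dxy dij.
  by move=> ok; move: ijd xyd; rewrite ok /= => /eqP-> /eqP->.
apply: st gH; rewrite -te; apply: (subsetP DD'); apply: (subsetP FD).
by rewrite inE tF.
Qed.

End Spanned.

Section Glue.
Local Open Scope ring_scope.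

Lemma place_shift tau p m x y :
  place tau p (m + x, m + y)%N = place tau (place tau p (m, m)) (x, y).
Proof. by rewrite /place; case: tau => /=; congr pair; lia. Qed.

Definition tbox (tau : bool) (w h : nat) (p : tile) : figure :=
  if tau then rect h w p else rect w h p.

Lemma tboxP tau w h p u v t :
  reflect (exists2 c, c \in box w h u v & t = place tau p c)
          (t \in tbox tau w h (place tau p (u, v))).
Proof.
apply: (iffP idP) => [|[[x y]]]; last first.
  rewrite mem_box => /= xy ->; rewrite /tbox /place.
  by case: tau; rewrite in_rect /=; lia.
case: t => x y; rewrite /tbox /place; case: tau; rewrite in_rect /= => h0.
  exists (absz (y - p.2), absz (x - p.1)); first by rewrite mem_box /=; lia.
  by congr pair => /=; lia.
exists (absz (x - p.1), absz (y - p.2)); first by rewrite mem_box /=; lia.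
by congr pair => /=; lia.
Qed.

Variable k : nat.

Lemma hue_adjacent c s t : adjacent s t -> hue k c s || hue k c t.
Proof.
case: s t => sx sy [tx ty]; rewrite /adjacent /hue /= => st.
by case: odd; case: c => //=; lia.
Qed.

Hypothesis k1 : (1 < k)%N.

Lemma piece_eq c R1 R2 : is_piece k R1 -> is_piece k R2 ->
  (forall t, t \in R1 -> hue k c t -> t \in R2) -> R1 = R2.
Proof.
move=> pR1 pR2 R12.
have near s t : s \in R1 -> t \in R1 -> adjacent s t -> (s \in R2) || (t \in R2).
  move=> s1 t1 /(hue_adjacent c)/orP[]/R12 h; apply/orP; [left | right]; exact: h.
have dims w1 h1 w h px py qx qy : (1 < w1)%N -> (1 < h1)%N ->
    R1 = rect w1 h1 (px, py) -> R2 = rect w h (qx, qy) ->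
    [/\ qx <= px, px + w1%:Z <= qx + w%:Z, qy <= py & py + h1%:Z <= qy + h%:Z].
  move=> w11 h11 E1 E2.
  have n1 := near (px, py) (px, py + 1); have n2 := near (px, py) (px + 1, py).
  have n3 := near (px + w1%:Z - 1, py) (px + w1%:Z - 1, py + 1).
  have n4 := near (px, py + h1%:Z - 1) (px + 1, py + h1%:Z - 1).
  move: n1 n2 n3 n4; rewrite /adjacent E1 E2 !in_rect /= => n1 n2 n3 n4.
  split; lia.
case: pR1 pR2 => [[px py] E1] [[qx qy] E2].
have k0 : (1 < k.+1)%N by lia.
case: E1 E2 => E1 [] E2; have := dims _ _ _ _ _ _ _ _ _ _ E1 E2.
- case/(_ k1 k0) => ? ? ? ?; rewrite E1 E2; congr rect; congr pair; lia.
- case/(_ k1 k0); lia.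
- case/(_ k0 k1); lia.
- case/(_ k0 k1) => ? ? ? ?; rewrite E1 E2; congr rect; congr pair; lia.
Qed.

Lemma piece_tbox R : is_piece k R -> forall tau, exists tall q,
  R = tbox tau (k + ~~ tall)%N (k + tall)%N q.
Proof.
move=> [q [] ->] []; [exists false, q | exists true, q | exists true, q | exists false, q];
  by rewrite /tbox /= addn0 addn1.
Qed.

Lemma pair_place R1 R2 : is_piece k R1 -> is_piece k R2 -> overlaps k R1 R2 ->
    R1 <> R2 ->
  exists tau p tall u v, [/\ R1 = tbox tau k.+1 k (place tau p (k.+1, k.+1)),
    R2 = tbox tau (k + ~~ tall)%N (k + tall)%N (place tau p (u, v))
    & pair_ok k tall u v].
Proof.
move=> pR1 pR2 ov R12.
have [tau [p0 E1]] : exists tau p0, R1 = tbox tau k.+1 k p0.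
  by case: pR1 => p0 [] ->; [exists true, p0 | exists false, p0].
have [tall [q E2]] := piece_tbox pR2 tau.
pose p : tile := (p0.1 - k.+1%:Z, p0.2 - k.+1%:Z).
have Ep : p0 = place tau p (k.+1, k.+1).
  by case: (p0) @p => x y p; rewrite /place /p; case: (tau); congr pair => /=; lia.
have [t tR] : exists t, t \in (R1 `&` R2)%fset.
  by move: ov; rewrite /overlaps; case: odd => [[s [t []]]|[t]]; [exists s | exists t].
pose x := if tau then q.2 - p.2 else q.1 - p.1.
pose y := if tau then q.1 - p.1 else q.2 - p.2.
have [x0 y0] : 0 <= x /\ 0 <= y.
  move: tR; rewrite inE E1 E2 /x /y /p /tbox.
  by case: (tau); rewrite !in_rect /=; case: (tall) => /=; split; lia.
exists tau, p, tall, `|x|%N, `|y|%N.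
have Eq : q = place tau p (`|x|%N, `|y|%N).
  move: x0 y0; rewrite /place /x /y.
  by case: (q) (tau) => qx qy [] /= ? ?; congr pair; lia.
rewrite -Ep -Eq; split=> //.
have ne : tall || ((`|x|%N, `|y|%N) != (k.+1, k.+1)).
  case: (boolP tall) E2 => //= nt E2; apply/eqP=> Exy; apply: R12.
  by rewrite E1 E2 Eq Ep Exy addn0 addn1.
rewrite /pair_ok ne andbT.
have ov' : forall t, t \in (R1 `&` R2)%fset -> exists2 c,
    c \in box k.+1 k k.+1 k.+1 /\ c \in box (k + ~~ tall) (k + tall) `|x|%N `|y|%N
    & t = place tau p c.
  move=> s; rewrite inE E1 E2 Ep Eq => /andP[/tboxP[c cb ->] /tboxP[d db]].
  by move/place_inj=> cd; exists c; rewrite // {2}cd.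
have [[i j] []] := ov' _ tR; rewrite !mem_box /= => h1 h2 _.
have ok : odd k -> [&& `|x|.+1 < k.+1 + k.+1 & k.+2 < `|x| + (k + ~~ tall)]%N
    || [&& `|y|.+1 < k.+1 + k & k.+2 < `|y| + (k + tall)]%N.
  move=> okk; move: ov; rewrite /overlaps okk => -[s [s' [/ov'[[a b] [ab1 ab2] ->]]]].
  case/ov' => -[a' b'] [ab1' ab2'] ->; move: ab1 ab2 ab1' ab2'.
  by rewrite !mem_box /adjacent /place; case: (tau) => /=; lia.
by apply/and5P; split; [lia | lia | lia | lia | apply/implyP].
Qed.

End Glue.

Section Admissible.
Local Open Scope ring_scope.
Variables (k : nat) (E : figure).
Hypothesis k1 : (1 < k)%N.

Lemma overlaps_hue F R c : overlaps k F R ->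
  exists2 t, t \in (F `&` R)%fset & hue k c t.
Proof.
rewrite /overlaps; have [ok | ek] := boolP (odd k).
  case=> s [t [sFR tFR /(hue_adjacent k c)/orP[]]]; first by exists s.
  by exists t.
by case=> t tFR; exists t; rewrite // /hue (negPf ek).
Qed.

Lemma spanned_pair R1 R2 c : (k < 4)%N -> is_piece k R1 -> is_piece k R2 ->
    overlaps k R1 R2 -> R1 <> R2 -> (R1 `<=` E)%fset -> (R2 `<=` E)%fset ->
  spanned k E (R1 `|` R2)%fset c.
Proof.
move=> k4 pR1 pR2 ov R12 R1E R2E.
have [tau [p [tall [u [v [E1 E2 ok]]]]]] := pair_place k1 pR1 pR2 ov R12.
pose pts := pair_pts k tall u v.
have inpts d : (d \in pts) = (d \in box k.+1 k k.+1 k.+1)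
    || (d \in box (k + ~~ tall) (k + tall) u v).
  by rewrite mem_cat; case: tall {E2 ok} @pts => /=; rewrite addn0 addn1.
have /fsubsetP R1E' := R1E; have /fsubsetP R2E' := R2E.
have dE d : d \in pts -> place tau p d \in E.
  rewrite inpts => /orP[] db; [apply: R1E'; rewrite E1 | apply: R2E'; rewrite E2];
    by apply/tboxP; exists d.
have k0 : (0 < k)%N by lia.
have t0 : E.
  by exists (place tau p (k.+1, k.+1)); apply: dE; rewrite inpts !mem_box /=; lia.
set e := chart t0 tau p.
have e_inj : {in [in pts] &, injective e} := @chart_inj E t0 tau p [in pts] dE.
have cs q : q \in pair_corners k tall u v ->
    exists2 s, s \in puzzle_group k E & acts e [in pts] s (rot k q.1 q.2).
  move=> qc; apply: (@chart_acts k E t0 tau p q.1 q.2 [in pts] k0 dE) => x y.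
  move=> xq yq; rewrite inpts !mem_box /=; move: qc xq yq; rewrite /pair_corners.
  by case: (tall); rewrite !inE => /or4P[]/eqP-> /= ? ?; lia.
pose d := c (+) odd (absz ((place tau p (k.+1, k.+1)).1
                         + (place tau p (k.+1, k.+1)).2)).
have k14 : (1 < k < 4)%N by rewrite k1.
have [word [fac [wl chk]]] := pair_cert_exists d k14 ok.
have [A [A3 tA [j [jk ej cj]] [j' [jk' ej']]]] :=
  bridge_cert (corners := pair_corners k tall u v) e_inj wl cs chk.
clear chk.
pose q := place tau p (k.+1, k.+1).
have eE x : e (k.+1 + x.1, k.+1 + x.2)%N = chart t0 tau q x.
  by case: x => x y; rewrite /e /chart place_shift.
have br : bridge k (puzzle_group k E) (chart t0 tau q) d.
  exists A; split=> //.
    by exists j; split=> //; [rewrite -eE | move=> okk; rewrite cj ?okk].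
  by exists j'; rewrite -eE.
have qE x : cdom k x -> place tau q x \in E.
  case: x => x y dxy; rewrite -place_shift; apply: dE; rewrite inpts !mem_box.
  by move: dxy; rewrite /cdom /=; clear; lia.
have cq x y u0 : (u0 <= 1)%N -> (u0 <= x < u0 + k)%N -> (0 <= y < 0 + k)%N -> cdom k (x, y).
  by rewrite /cdom /=; clear; lia.
have [|a aG aa] := @chart_acts k E t0 tau q 0 0 (cdom k) k0 qE.
  by move=> x y; apply: cq.
have [|b bG ab] := @chart_acts k E t0 tau q 1 0 (cdom k) k0 qE.
  by move=> x y; apply: cq.
have [D [D3 tD eD]] := tri_bridge k1 aa ab aG bG br.
have s1 : spanned k E R1 c.
  exists D; split=> //; apply/subsetP=> t; rewrite inE E1 => /andP[/tboxP[[x y]]].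
  rewrite mem_box /= => xy tE; pose x' := (x - k.+1)%N; pose y' := (y - k.+1)%N.
  have dxy : cdom k (x', y') by move: xy; rewrite /cdom /x' /y' /=; clear; lia.
  have tE' : val t = place tau q (x', y').
    by rewrite -place_shift !subnKC //; case/andP: xy => /andP[xk _] /andP[yk _].
  have -> : t = chart t0 tau q (x', y') by apply: val_inj; rewrite chart_val ?qE.
  move=> h; apply: eD; [by case/andP: dxy | by case/andP: dxy | move=> okk].
  by move: h; rewrite chart_val ?qE // hue_place // => /eqP.
have [t tR th] := overlaps_hue c ov; move: tR; rewrite inE => /andP[t1 t2].
apply: (spanned_spread k1 (t := [` R1E' _ t1]%fset)) => //.
apply/negP=> /subsetP R12c; apply: R12; apply: (piece_eq k1 (c := c)) => // s sR1 sh.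
have := R12c [` R1E' _ sR1]%fset; rewrite !inE /= sR1 sh => /(_ isT).
by case/andP.
Qed.

Lemma admissible_piece_or F : admissible k F -> (F `<=` E)%fset -> (k < 4)%N ->
  is_piece k F \/ (exists2 R, is_piece k R & (R `<=` F)%fset)
                 /\ forall c, spanned k E F c.
Proof.
move=> aF + k4; elim: aF => [R pR _ | {}F R aF IHF pR ov]; first by left.
rewrite fsubUset => /andP[FE RE]; have [pF | [[R1 pR1 R1F] sF]] := IHF FE.
  have [-> | /eqP FR] := eqVneq F R; first by left; rewrite fsetUid.
  right; split; last by move=> c; apply: spanned_pair.
  by exists F; rewrite // fsubsetUl.
right; split; first by exists R1; rewrite // (fsubset_trans R1F) ?fsubsetUl.
move=> c; have [FR | FR] := boolP (part k E F c \subset part k E R c).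
  have E1 : R1 = R.
    apply: (piece_eq k1 (c := c)) => // s sR1 sh.
    have sF' := fsubsetP R1F _ sR1; have sE := fsubsetP FE _ sF'.
    by have := subsetP FR [` sE]%fset; rewrite !inE /= sF' sh => /(_ isT)/andP[].
  by have -> : (F `|` R)%fset = F by apply/fsetUidPl; rewrite -E1.
have [t tR th] := overlaps_hue c ov; move: tR; rewrite inE => /andP[tF tR].
exact: (spanned_spread k1 (t := [` fsubsetP FE _ tF]%fset)).
Qed.

Lemma admissible_spanned F c : admissible k F -> (F `<=` E)%fset ->
  (3 < k)%N \/ ~ is_piece k F -> spanned k E F c.
Proof.
move=> aF FE; have [k3 _ | k4] := ltnP 3 k; last first.
  by case=> // nF; have [/nF | [_]] := admissible_piece_or aF FE k4.
elim: aF FE => [R pR RE | {}F R aF IHF pR ov]; first exact: spanned_large.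
rewrite fsubUset => /andP[FE RE].
have [t tR th] := overlaps_hue c ov; move: tR; rewrite inE => /andP[tF tR].
apply: (spanned_merge (t := [` fsubsetP FE _ tF]%fset)) => //; first exact: IHF.
exact: spanned_large.
Qed.

End Admissible.

(** * Parity of the moves *)

(* D is a transversal of the nontrivial cycles of s, all of length 4. *)
Lemma odd_four_cycles (T : finType) (s : {perm T}) (D : {set T}) :
    s ^+ 4 = 1%g ->
    (forall d i, d \in D -> 0 < i < 4 -> (s ^+ i)%g d \notin D) ->
    (forall x, s x != x -> exists i, exists2 d, d \in D & x = (s ^+ i)%g d) ->
  odd_perm s = odd #|D|.
Proof.
move=> s4 DN Dall; pose Fx := [set x | s x == x].
have DFx : [disjoint D & Fx].
  apply/pred0P=> x /=; apply/andP=> -[xD]; rewrite inE => /eqP sx.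
  by have := DN x 1 xD isT; rewrite expg1 sx xD.
have sFx j x : (s ^+ j)%g x \in Fx -> x \in Fx.
  rewrite !inE -permM -expgSr expgS permM => /eqP/perm_inj sx; exact/eqP.
have sFxj j x : x \in Fx -> (s ^+ j)%g x = x.
  rewrite inE => /eqP sx; elim: j => [|j IHj]; first by rewrite perm1.
  by rewrite expgS permM sx.
have eT : odd #|T| = odd #|Fx|.
  have p2 : 2.-group <[s]>.
    by apply: (@pnat_dvd _ 4) => //; rewrite -orderE order_dvdn s4.
  have nS : [acts <[s]>, on [set: T] | 'P].
    by apply/subsetP=> x _; rewrite !inE; apply/subsetP=> y; rewrite !inE.
  have := pgroup_fix_mod p2 nS; rewrite cardsT !modn2 => E.
  have -> : odd #|T| = odd #|'Fix_([set: T] | 'P)(<[s]>)| by case: odd E; case: odd.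
  congr (odd #|pred_of_set _|).
  by apply/setP=> x; rewrite in_setI in_setT afix_cycle [in RHS]inE /=; apply/afix1P/eqP.
rewrite /odd_perm eT.
have -> : porbits s = porbit s @: (D :|: Fx).
  apply/setP=> P; apply/imsetP/imsetP=> -[x xD ->]; last by exists x.
  have [sx | /Dall[i [d dD ->]]] := eqVneq (s x) x.
    by exists x; rewrite // !inE sx eqxx orbT.
  by exists d; [rewrite inE dD | apply/eqP; rewrite eq_porbit_mem mem_porbit].
rewrite card_in_imset.
  rewrite cardsU; move/disjoint_setI0: DFx => ->.
  by rewrite cards0 subn0 oddD addbC -addbA addbb addbF.
move=> x y; rewrite !inE => xD yD /eqP; rewrite eq_sym eq_porbit_mem.
case/porbitP=> i; rewrite -(expg_mod i s4) => yx.
have yFx : y \in Fx -> x = y.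
  by rewrite {1}yx => /sFx xF; rewrite yx sFxj.
case/orP: xD => [xD | xF]; last by rewrite yx sFxj // inE.
case/orP: yD => [yD | ?]; last by apply: yFx; rewrite inE.
move: yx yD; case: (posnP (i %% 4)) => [-> | i0 ->]; first by rewrite perm1.
by rewrite (negPf (DN _ _ _ _)) // i0 ltn_mod.
Qed.

Lemma sum_parity n h (d : bool) :
  \sum_(i < n.*2) \sum_(j < h) (odd (i + j) == d) = n * h.
Proof.
elim: n => [|n IHn]; first by rewrite big_ord0.
rewrite doubleS !big_ord_recr /= {}IHn -addnA -big_split /= mulSnr; congr addn.
rewrite (eq_bigr (fun=> 1)) ?sum1_card ?card_ord // => j _.
by rewrite /=; case: odd; case: d.
Qed.

Lemma odd_checkerboard m (d : bool) :
  odd (\sum_(i < m.+1) \sum_(j < m) (odd (i + j) == d)) = odd (uphalf m).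
Proof.
have sumE w h n : w = n.*2 -> \sum_(i < w) \sum_(j < h) (odd (i + j) == d) = n * h.
  by move->; apply: sum_parity.
have [om | em] := boolP (odd m).
  by rewrite (sumE _ _ (uphalf m)) ?oddM ?om ?andbT //; lia.
rewrite exchange_big; under eq_bigr do under eq_bigr do rewrite addnC.
by rewrite (sumE _ _ (uphalf m)) ?oddM /= ?em ?andbT //; lia.
Qed.

Section Moves.
Local Open Scope ring_scope.
Variables (k : nat) (F : figure).
Definition bdom (c : crd) : bool := (c.1 < k)%N && (c.2 < k)%N.

Lemma rot_bdom c : bdom c -> bdom (rot k 0 0 c).
Proof. by case: c => x y; rewrite /bdom /rot /= => xy; case: ifP => /=; lia. Qed.

Lemma rot_iter i c : (i < 4)%N -> bdom c ->
  iter i (rot k 0 0) c = nth c [:: c; (c.2, k.-1 - c.1); (k.-1 - c.1, k.-1 - c.2);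
                                   (k.-1 - c.2, c.1)]%N i.
Proof.
have E x y : bdom (x, y) -> rot k 0 0 (x, y) = (y, k.-1 - x)%N.
  by rewrite /bdom /rot /= => xy; rewrite ifT; [congr pair; lia | lia].
case: c => x y i4 dxy; move: (rot k 0 0) E => r E.
move: dxy; rewrite /bdom /= => xy.
case: i i4 => [|[|[|[|i]]]] // _; rewrite /= !E /bdom /=; try lia; congr pair; lia.
Qed.

Lemma rot_iter4 c : bdom c -> iter 4 (rot k 0 0) c = c.
Proof.
move=> dc; rewrite iterS rot_iter //; case: c dc => x y.
rewrite /bdom /rot /= => xy; rewrite ifT; [congr pair; lia | lia].
Qed.

Hypothesis k0 : (0 < k)%N.

Lemma move_chart s : s \in moves k F -> exists (e : crd -> F) (p : tile),
  [/\ acts e bdom s (rot k 0 0), {in bdom &, injective e}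
    & forall c, bdom c -> val (e c) = place false p c].
Proof.
case/movesP=> p /fsubsetP bF st.
have dF c : bdom c -> place false p c \in F.
  by case: c => x y xy; apply: bF; rewrite in_rect /place; move: xy; rewrite /bdom /=; lia.
have t0 : F by exists (place false p (0, 0)%N); apply: dF; rewrite /bdom /= k0.
exists (chart t0 false p), p; split; last first.
- by move=> c dc; rewrite chart_val ?dF.
- exact: chart_inj dF.
split=> [c dc | x].
  have rc := rot_bdom dc; split=> //; apply: val_inj; rewrite st !chart_val ?dF //.
  rewrite -(turn_place k false p 0 0 c) /=; congr turn.
  by case: (p) => px py; rewrite /place /=; congr pair; lia.
rewrite -val_eqE st /turn; case: ifP => [+ _ | _]; last by rewrite eqxx.
rewrite in_rect => xp; exists (absz ((val x).1 - p.1), absz ((val x).2 - p.2)).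
  by move: xp; rewrite /bdom /=; lia.
apply: val_inj; rewrite chart_val.
  by case: (val x) xp => x1 x2 /= xp; rewrite /place /=; congr pair; lia.
by apply: dF; move: xp; rewrite /bdom /=; lia.
Qed.

Lemma odd_restr_move s (B : {set F}) : s \in moves k F -> s \in 'N(B | 'P) ->
  exists2 p, (forall c, bdom c -> place false p c \in F) & odd_perm (restr_perm B s)
   = odd (\sum_(i < uphalf k) \sum_(j < k./2)
        [exists t in B, val t == place false p (i : nat, j : nat)]).
Proof.
move=> sM sN; have [e [p [as_ e_inj eE]]] := move_chart sM; exists p.
  by move=> c /eE <-; apply: valP.
set r := restr_perm B s.
have rB x : x \in B -> r x = s x by move=> xB; apply: restr_permE.
have rC x : x \notin B -> r x = x by move=> xB; apply: (out_perm (restr_perm_on _ _)).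
have sB x : (s x \in B) = (x \in B) by apply: (astabs_act x sN).
have sXB i x : ((s ^+ i)%g x \in B) = (x \in B).
  by elim: i => [|i IHi]; rewrite ?perm1 // expgSr permM sB.
have rX i x : (r ^+ i)%g x = if x \in B then (s ^+ i)%g x else x.
  elim: i => [|i IHi]; first by rewrite !perm1 if_same.
  rewrite !expgSr !permM IHi; case: ifP => xB; last by rewrite rC ?xB.
  by rewrite rB ?sXB.
have sX i c : bdom c -> (s ^+ i)%g (e c) = e (iter i (rot k 0 0) c).
  by move=> dc; have [] := (acts_exp i as_).1 c dc.
pose q (x : 'I_(uphalf k) * 'I_(k./2)) : crd := (x.1 : nat, x.2 : nat).
have qd x : bdom (q x).
  by rewrite /bdom /q /=; have := ltn_ord x.1; have := ltn_ord x.2; lia.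
have q_inj : injective q by move=> [x y] [x' y'] [] /ord_inj-> /ord_inj->.
pose D := [set e (q x) | x in [set x | e (q x) \in B]].
have -> : odd_perm r = odd #|D|.
  apply: odd_four_cycles.
  - apply/permP=> x; rewrite rX perm1; case: ifP => // xB.
    have [sx | /as_.2[c dc ->]] := eqVneq (s x) x.
      by elim: 4%N => [|i IHi]; rewrite ?perm1 // expgS permM sx.
    by rewrite sX // rot_iter4.
  - move=> _ i /imsetP[x xB ->] i4; rewrite inE in xB; rewrite rX xB sX //.
    have dI c j : bdom c -> bdom (iter j (rot k 0 0) c).
      by move=> dc; elim: j => //= j /rot_bdom.
    apply/negP=> /imsetP[y _ /(e_inj _ _ (dI _ i (qd x)) (qd y))].
    have := ltn_ord x.1; have := ltn_ord x.2; have := ltn_ord y.1; have := ltn_ord y.2.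
    case/andP: i4 => i0 i4 y2 y1 x2 x1; rewrite rot_iter //.
    rewrite /q /=; move: (x.1 : nat) (x.2 : nat) (y.1 : nat) (y.2 : nat) y2 y1 x2 x1 => /=.
    move=> x1 x2 y1 y2 hy2 hy1 hx2 hx1; clear -i0 i4 hy2 hy1 hx2 hx1.
    case: i i0 i4 => [|[|[|[|i]]]] // _ _ /= -[]; lia.
  move=> x; have [xB | xB] := boolP (x \in B); last by rewrite rC // eqxx.
  rewrite rB // => sx; have [[i j] dij xE] := as_.2 x sx.
  have cov u v n : (u < uphalf k)%N -> (v < k./2)%N -> (n < 4)%N ->
      iter n (rot k 0 0) (u, v) = (i, j) ->
    exists n0, exists2 d, d \in D & x = (r ^+ n0)%g d.
    move=> uk vk n4 E; pose y : 'I_(uphalf k) * 'I_(k./2) := (Ordinal uk, Ordinal vk).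
    have yE : (s ^+ n)%g (e (q y)) = x by rewrite sX // E.
    have yB : e (q y) \in B by rewrite -(sXB n) yE.
    exists n, (e (q y)); last by rewrite rX yB.
    by apply/imsetP; exists y; rewrite // inE.
  have bd u v : (u < uphalf k)%N -> (v < k./2)%N -> bdom (u, v).
    by rewrite /bdom /=; lia.
  have ij : (i < k)%N && (j < k)%N by move: dij.
  have [c1 | c1] := boolP ((i < uphalf k) && (j < k./2))%N.
    by apply: (cov i j 0) => //; lia.
  have [c2 | c2] := boolP ((k.-1 - j < uphalf k) && (i < k./2))%N.
    have [u1 v1] := andP c2; apply: (cov _ _ 1 u1 v1) => //.
    by rewrite rot_iter ?bd //=; congr pair; lia.
  have [cycle3 | cycle3] := boolP ((k.-1 - i < uphalf k) && (k.-1 - j < k./2))%N.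
    have [u1 v1] := andP cycle3; apply: (cov _ _ 2 u1 v1) => //.
    by rewrite rot_iter ?bd //=; congr pair; lia.
  have [c4 | c4] := boolP ((j < uphalf k) && (k.-1 - i < k./2))%N.
    have [u1 v1] := andP c4; apply: (cov _ _ 3 u1 v1) => //.
    by rewrite rot_iter ?bd //=; congr pair; lia.
  move: sx; rewrite xE (as_.1 _ dij).2 -[rot k 0 0 _]/(iter 1 (rot k 0 0) _).
  rewrite rot_iter //= (inj_in_eq e_inj) //; last by rewrite unfold_in /bdom /=; lia.
  by rewrite xpair_eqE; lia.
rewrite card_in_imset => [|x y _ _ /(e_inj _ _ (qd x) (qd y))/q_inj //].
rewrite -sum1_card pair_big big_mkcond /=; congr odd; apply: eq_bigr => x _.
rewrite inE; have -> : (e (q x) \in B)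
    = [exists t in B, val t == place false p (x.1 : nat, x.2 : nat)].
  apply/idP/exists_inP => [xB | [t tB /eqP tx]].
    by exists (e (q x)); rewrite // eE.
  by have -> : e (q x) = t by apply: val_inj; rewrite eE.
by case: [exists _ in _, _].
Qed.

End Moves.

Section Parity.
Local Open Scope ring_scope.
Variables (k : nat) (F : figure).
Lemma moves_black c : odd k -> {subset moves k F <= 'N(black c F | 'P)}.
Proof.
move=> ok s /movesP[p _ st]; rewrite !inE; apply/subsetP=> t; rewrite !inE /= apermE st.
rewrite /turn; case: ifP => // _ /eqP <-; apply/eqP.
by clear st; rewrite -[fsval t]/(val t); case: (val t) p => x y [px py] /=; lia.
Qed.

Hypothesis k0 : (0 < k)%N.

Lemma odd_move_even s : ~~ odd k -> s \in moves k F -> odd_perm s = odd k./2.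
Proof.
move=> ek sM; have [| p pF] := odd_restr_move k0 (B := setT) sM.
  by rewrite !inE; apply/subsetP=> t; rewrite !inE.
have -> : restr_perm [set: F] s = s.
  apply/permP=> t; rewrite restr_permE ?inE //.
  by apply/subsetP=> u; rewrite !inE.
move->; rewrite (eq_bigr (fun=> k./2)) => [|i _].
  rewrite sum_nat_const card_ord oddM uphalf_half (negPf ek) /= add0n.
  by rewrite andbb.
rewrite (eq_bigr (fun=> 1%N)) ?sum1_card ?card_ord // => j _.
have dij : bdom k (i : nat, j : nat).
  by rewrite /bdom /=; have := ltn_ord i; have := ltn_ord j; lia.
rewrite (_ : [exists t in _, _]) //; apply/exists_inP.
by exists [` pF _ dij]%fset; rewrite ?inE //=.
Qed.

Lemma odd_move_black c s : odd k -> s \in moves k F ->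
  odd_perm (restr_perm (black c F) s) = odd (uphalf k./2).
Proof.
move=> ok sM; have [p pF ->] := odd_restr_move k0 sM (moves_black c ok sM).
have uk : uphalf k = k./2.+1 by rewrite uphalf_half ok.
rewrite uk -(odd_checkerboard k./2 (c (+) odd (absz (p.1 + p.2)))); congr odd.
apply: eq_bigr => i _; apply: eq_bigr => j _; congr nat_of_bool.
have dij : bdom k (i : nat, j : nat).
  by rewrite /bdom /=; have := ltn_ord i; have := ltn_ord j; lia.
have h : hue k c (place false p (i : nat, j : nat))
    = (odd (absz ((place false p (i : nat, j : nat)).1
                + (place false p (i : nat, j : nat)).2)) == c) by rewrite /hue ok.
rewrite -(hue_place false p c i j ok) h; apply/exists_inP/idP => [[t] | hc].
  by rewrite inE => tc /eqP <-.
by exists [` pF _ dij]%fset; rewrite ?inE //=.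
Qed.

Lemma admissible_piece_sub G : admissible k G ->
  exists2 R, is_piece k R & (R `<=` G)%fset.
Proof.
elim=> [R pR | {}G R _ [R' pR' R'G] _ _]; first by exists R.
by exists R'; rewrite // (fsubset_trans R'G) ?fsubsetUl.
Qed.

Lemma moves_neq0 : admissible k F -> exists s, s \in moves k F.
Proof.
move=> /admissible_piece_sub[R [q [] E] RF].
  have [|s sM _] := move_exists (k := k) (F := F) (p := q) k0; last by exists s.
  apply: fsubset_trans RF; apply/fsubsetP=> t; rewrite E !in_rect; lia.
have [|s sM _] := move_exists (k := k) (F := F) (p := q) k0; last by exists s.
apply: fsubset_trans RF; apply/fsubsetP=> t; rewrite E !in_rect; lia.
Qed.

End Parity.

Lemma card_rect w h p : #|` rect w h p|%fset = w * h.
Proof.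
pose f (x : 'I_w * 'I_h) : tile := (p.1 + (x.1 : nat)%:Z, p.2 + (x.2 : nat)%:Z)%R.
have f_inj : injective f.
  by move=> [i j] [i' j'] [] /= ? ?; congr pair; apply: val_inj => /=; lia.
have -> : rect w h p = [fset f x | x : 'I_w * 'I_h]%fset.
  apply/fsetP=> t; apply/imfset2P/imfsetP => /= [[i _ [j _ ->]] | [[i j] _ ->]].
    by exists (i, j).
  by exists i => //; exists j.
by rewrite card_imfset //= -cardE card_prod !card_ord.
Qed.

Lemma card_piece k R : is_piece k R -> #|` R|%fset = k * k.+1.
Proof. by case=> p [] ->; rewrite card_rect // mulnC. Qed.

Section EvenCase.
Variables (k : nat) (F : figure).
Hypothesis k1 : 1 < k.
Hypothesis aF : admissible k F.
Local Notation G := (puzzle_group k F).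

Lemma alt_part c : (3 < k) \/ #|` F|%fset <> k * k.+1 ->
  alt_on (part k F F c) \subset G.
Proof.
move=> kF; have [||D [_ tD FD]] := @admissible_spanned k F k1 F c aF.
- exact: fsubset_refl.
- by case: kF; [left | right=> /card_piece].
exact: tri_alt_on (triS FD tD).
Qed.

Lemma puzzle_even : ~~ odd k -> #|` F|%fset <> 6 ->
  (k = 0 %[mod 4] -> G = 'Alt_F :> {set {perm F}}) /\
  (k = 2 %[mod 4] -> G = 'Sym_F :> {set {perm F}}).
Proof.
move=> ek F6; have k0 : 0 < k by lia.
have GA : 'Alt_F \subset G.
  have -> : 'Alt_F = alt_on (part k F F true) :> {set {perm F}}.
    apply/setP=> s; rewrite Alt_even mem_alt_on; symmetry.
    have -> : part k F F true = setT.
      by apply/setP=> t; rewrite !inE fsvalP /hue (negPf ek).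
    by rewrite (_ : perm_on _ _) //; apply/subsetP=> t; rewrite inE.
  apply: alt_part; have [k3 | k3] := ltnP 3 k; [by left | right].
  by have -> : k = 2 by lia.
have oM s : s \in moves k F -> odd_perm s = odd k./2 by apply: odd_move_even.
split=> k4.
  apply/eqP; rewrite eqEsubset GA andbT gen_subG; apply/subsetP=> s /oM os.
  by rewrite Alt_even os; move: k4; lia.
have [s0 s0M] := moves_neq0 k0 aF.
have os0 : odd_perm s0 by rewrite oM //; move: k4; lia.
have s0G : s0 \in G by apply: mem_gen.
apply/eqP; rewrite eqEsubset; apply/andP; split; apply/subsetP=> s _; first by rewrite inE.
have [os | es] := boolP (odd_perm s); last by apply: (subsetP GA); rewrite Alt_even.
by rewrite -(groupMr _ s0G) (subsetP GA) // Alt_even odd_permM os os0.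
Qed.

End EvenCase.

Section ProductParity.
Variables (T : finType) (B : {set T}).
Local Notation W := (~: B).
Implicit Types s u v : {perm T}.

Lemma disjoint_compl : [disjoint B & W].
Proof. by rewrite disjoints_subset setCK. Qed.

Lemma alt_onE (A : {set T}) : alt_on A = sym_on A :&: 'Alt_T.
Proof. by apply/setP=> s; rewrite mem_alt_on in_setI Alt_even [in RHS]inE. Qed.

Lemma sym_on_cent : sym_on W \subset 'C(sym_on B).
Proof.
apply/centsP=> v; rewrite inE => vW u; rewrite inE => uB.
exact/commute_sym/(perm_onC uB vW)/disjoint_compl.
Qed.

Lemma sym_on_capI : sym_on B :&: sym_on W = 1%g.
Proof.
apply/eqP; rewrite eqEsubset sub1G ?group1 andbT.
  apply/subsetP=> s; rewrite !inE => /andP[sB sW]; apply/eqP/permP=> t.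
  rewrite perm1; have [tB | tB] := boolP (t \in B).
    by apply: (out_perm sW); rewrite inE tB.
  exact: (out_perm sB).
Qed.

Lemma restr_prod s : s \in 'N(B | 'P) -> s = (restr_perm B s * restr_perm W s)%g.
Proof.
move=> sN; have sW : s \in 'N(W | 'P) by rewrite astabsC.
apply/permP=> t; rewrite permM; have [tB | tB] := boolP (t \in B).
  rewrite (restr_permE sN tB) (out_perm (restr_perm_on _ _)) // inE negbK.
  by rewrite -[s t]/('P%act t s) (astabs_act t sN).
by rewrite (out_perm (restr_perm_on B s) tB) restr_permE // inE.
Qed.

Lemma mem_sym_prod s : (s \in (sym_on B * sym_on W)%g) = (s \in 'N(B | 'P)).
Proof.
apply/idP/idP => [/mulsgP[u v] | sN].
  rewrite !inE => uB vW ->; apply/subsetP=> t tB; rewrite inE /= apermE permM.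
  have uvB : v (u t) = u t by apply: (out_perm vW); rewrite inE perm_closed // tB.
  by rewrite uvB perm_closed.
by rewrite (restr_prod sN) mem_mulg ?inE ?restr_perm_on.
Qed.

Lemma even_prodE :
  even_prod B W = [set s in (sym_on B * sym_on W)%g | ~~ odd_perm s].
Proof.
apply/setP=> s; rewrite [RHS]inE inE; apply/orP/andP => [[] | []].
- case/mulsgP=> u v; rewrite !mem_alt_on => /andP[uB uo] /andP[vW vo] ->.
  rewrite odd_permM (negPf uo) (negPf vo); split=> //.
  by rewrite mem_mulg ?inE.
- case/mulsgP=> u v; rewrite !inE => /andP[uo uB] /andP[vo vW] ->.
  rewrite uB /= negbK in uo; rewrite vW /= negbK in vo.
  by rewrite odd_permM uo vo; split=> //; rewrite mem_mulg ?inE.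
case/mulsgP=> u v uB vW ->; rewrite odd_permM => uv.
have [uo | ue] := boolP (odd_perm u); [right | left]; apply: mem_mulg.
- by rewrite !inE uo andbF /=; rewrite inE in uB.
- by rewrite uo /= negbK in uv; rewrite !inE uv andbF /=; rewrite inE in vW.
- by rewrite inE uB.
by rewrite (negPf ue) /= in uv; rewrite inE vW.
Qed.

End ProductParity.

Section OddCase.
Variables (k : nat) (F : figure).
Hypothesis k1 : 1 < k.
Hypothesis aF : admissible k F.
Hypothesis ok : odd k.
Hypothesis F12 : #|` F|%fset <> 12.
Local Notation G := (puzzle_group k F).

Lemma alt_black c : alt_on (black c F) \subset G.
Proof.
have -> : black c F = part k F F c.
  by apply/setP=> t; rewrite !inE fsvalP /hue ok.
apply: (alt_part k1 aF); have [k3 | k3] := ltnP 3 k; [by left | right].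
by have -> : k = 3 by lia.
Qed.

Lemma black_compl c : ~: black c F = black (~~ c) F.
Proof. by apply/setP=> t; rewrite !inE; case: odd; case: c. Qed.

Lemma alt_white c : alt_on (~: black c F) \subset G.
Proof. by rewrite black_compl alt_black. Qed.

Lemma puzzle_black c : {subset G <= 'N(black c F | 'P)}.
Proof.
by apply/subsetP; rewrite gen_subG; apply/subsetP=> s; apply: moves_black.
Qed.

Lemma odd_move_pair c s : s \in moves k F ->
  odd_perm (restr_perm (black c F) s) = odd (uphalf k./2) /\
  odd_perm (restr_perm (~: black c F) s) = odd (uphalf k./2).
Proof.
have k0 : 0 < k by lia.
by move=> sM; rewrite black_compl; split; apply: odd_move_black.
Qed.

Lemma puzzle_dprod c : ~~ odd (uphalf k./2) ->
  (alt_on (black c F) \x alt_on (~: black c F))%g = G.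
Proof.
move=> ek; set B := black c F; set W := ~: B.
have cBW : alt_on W \subset 'C(alt_on B).
  rewrite !alt_onE; apply: subset_trans (subsetIl _ _) _.
  by apply: subset_trans (sym_on_cent B) (centS (subsetIl _ _)).
have eB := alt_onE B; have eW := alt_onE W.
have iBW : alt_on B :&: alt_on W = 1%g.
  apply/eqP; rewrite eqEsubset sub1set inE !mem_alt_on !perm_on1 odd_perm1 andbT.
  by rewrite -(sym_on_capI B) eB eW; apply: setISS; apply: subsetIl.
rewrite eB eW in cBW iBW *; rewrite dprodE // -cent_joinEr //.
have aB : sym_on B :&: 'Alt_F \subset G by rewrite -eB alt_black.
have aW : sym_on W :&: 'Alt_F \subset G by rewrite -eW alt_white.
apply/eqP; rewrite eqEsubset join_subG aB aW /=.
rewrite gen_subG; apply/subsetP=> s sM.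
have sN := moves_black c ok sM; have [oB oW] := odd_move_pair c sM.
change (s \in (sym_on B :&: 'Alt_F) <*> (sym_on W :&: 'Alt_F)).
rewrite cent_joinEr // (restr_prod sN); apply: mem_mulg.
  by rewrite in_setI Alt_even oB inE restr_perm_on.
by rewrite in_setI Alt_even oW inE restr_perm_on.
Qed.

Lemma puzzle_even_prod c : odd (uphalf k./2) ->
  G = even_prod (black c F) (~: black c F) :> {set {perm F}}.
Proof.
move=> ek; set B := black c F; set W := ~: B; rewrite even_prodE.
have k0 : 0 < k by lia.
apply/eqP; rewrite eqEsubset; apply/andP; split.
  apply/subsetP=> s sG; rewrite inE mem_sym_prod puzzle_black //=.
  rewrite -Alt_even; move: s sG; apply/subsetP; rewrite gen_subG; apply/subsetP=> s sM.
  have [oB oW] := odd_move_pair c sM.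
  by rewrite Alt_even (restr_prod (moves_black c ok sM)) odd_permM oB oW addbb.
apply/subsetP=> s; rewrite inE => /andP[/mulsgP[u v uB vW ->]]; rewrite odd_permM.
have alt u' v' : u' \in sym_on B -> v' \in sym_on W -> ~~ odd_perm u' ->
    ~~ odd_perm v' -> (u' * v')%g \in G.
  move=> u'B v'W u'e v'e; rewrite groupM //.
    by apply: (subsetP (alt_black c)); rewrite inE u'B.
  by apply: (subsetP (alt_white c)); rewrite inE v'W.
have [uo vo | ue ve] := boolP (odd_perm u); last by apply: alt.
have {}vo : odd_perm v by move: vo; rewrite /= negbK.
have [s0 s0M] := moves_neq0 k0 aF.
have s0G : s0 \in G by apply: mem_gen.
have [oB oW] := odd_move_pair c s0M.
have rB : restr_perm B s0 \in sym_on B by rewrite inE restr_perm_on.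
have rW : restr_perm W s0 \in sym_on W by rewrite inE restr_perm_on.
rewrite -(groupMr _ s0G) (restr_prod (moves_black c ok s0M)) -/B -/W.
have cWB : (v * restr_perm B s0 = restr_perm B s0 * v)%g.
  by apply: (centsP (sym_on_cent B)).
rewrite -mulgA (mulgA v) cWB -(mulgA _ v) (mulgA u).
apply: alt; rewrite ?groupM //.
  by rewrite odd_permM uo oB ek.
by rewrite odd_permM vo oW ek.
Qed.

End OddCase.

(** * The group PGL_2(5) *)

Section PGL.
Local Open Scope ring_scope.
Import GRing.Theory.

Lemma moebius_scale (K : finFieldType) (x a b c d : K) z : x != 0 ->
  moebius (x * a) (x * b) (x * c) (x * d) z = moebius a b c d z.
Proof.
move=> x0; case: z => [z|] /=.
  rewrite -!mulrA -!mulrDr mulf_eq0 (negPf x0) /=; case: eqP => // _.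
  by rewrite -mulf_div divff // mul1r.
by rewrite mulf_eq0 (negPf x0) /=; case: eqP => // _; rewrite -mulf_div divff // mul1r.
Qed.

Lemma moebius1 (K : finFieldType) z : moebius (1 : K) 0 0 1 z = z.
Proof.
case: z => [z|] /=; last by rewrite eqxx.
by rewrite mul0r add0r oner_eq0 mul1r addr0 divr1.
Qed.

Lemma gen_ind (gT : finGroupType) (A : {set gT}) (P : gT -> Prop) :
  P 1%g -> (forall x y, P x -> y \in A -> P (x * y)%g) ->
  forall x, x \in <<A>>%g -> P x.
Proof.
move=> P1 PM x /gen_prodgP[n [c cA ->]]; elim: n c cA => [|n IHn] c cA.
  by rewrite big_ord0.
by rewrite big_ord_recr; apply: PM => //; apply: IHn => i; apply: cA.
Qed.

Section Bruhat.
Variables (K : finFieldType) (H : {group {perm proj_line K}}).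

Definition realizes (a b c d : K) : Prop :=
  exists2 g, g \in H & g =1 moebius a b c d.

Lemma realizes_mul a b c d a' b' c' d' : a * d - b * c != 0 ->
    realizes a b c d -> realizes a' b' c' d' ->
  realizes (a' * a + b' * c) (a' * b + b' * d) (c' * a + d' * c) (c' * b + d' * d).
Proof.
move=> h [g gH gE] [g' gH' gE']; exists (g * g')%g; first by rewrite groupM.
by move=> z; rewrite permM gE gE' moebius_comp.
Qed.

Lemma realizes_mulE a b c d a' b' c' d' a2 b2 c2 d2 : a * d - b * c != 0 ->
    realizes a b c d -> realizes a' b' c' d' ->
    [&& a' * a + b' * c == a2, a' * b + b' * d == b2, c' * a + d' * c == c2
      & c' * b + d' * d == d2] -> realizes a2 b2 c2 d2.
Proof.
by move=> h r r' /and4P[/eqP<- /eqP<- /eqP<- /eqP<-]; apply: realizes_mul.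
Qed.

Lemma realizes_scale x a b c d : x != 0 ->
  realizes (x * a) (x * b) (x * c) (x * d) -> realizes a b c d.
Proof.
by move=> x0 [g gH gE]; exists g => // z; rewrite gE moebius_scale.
Qed.

Lemma PGL2_bruhat :
    (forall u, realizes 1 u 0 1) -> (forall v, v != 0 -> realizes v 0 0 1) ->
    realizes 0 1 1 0 ->
  PGL2 K \subset H.
Proof.
move=> realizes_shift realizes_dilation hI; apply/subsetP=> g /PGL2P[a [b [c [d [h gE]]]]].
suff [g' gH' gE'] : realizes a b c d.
  by rewrite (_ : g = g') //; apply/permP=> z; rewrite gE gE'.
have [c0 | c0] := eqVneq c 0.
  move: h; rewrite c0 mulr0 subr0 mulf_eq0 negb_or => /andP[a0 d0].
  have h1 : realizes (a / d) 0 0 1 by apply: realizes_dilation; rewrite mulf_neq0 ?invr_eq0.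
  apply: (realizes_scale (x := d^-1)); rewrite ?invr_eq0 //.
  apply: (realizes_mulE _ h1 (realizes_shift (b / d))).
    by rewrite mulr1 mulr0 subr0 mulf_neq0 ?invr_eq0.
  rewrite !(mulr1, mul1r, mulr0, mul0r, addr0, add0r) mulVf // !eqxx.
  by rewrite [a / d]mulrC [b / d]mulrC !eqxx.
have h2 : realizes 0 1 1 (d / c).
  apply: (realizes_mulE _ (realizes_shift (d / c)) hI).
    by rewrite mulr0 subr0 mulr1 oner_neq0.
  by rewrite !(mulr1, mul1r, mulr0, mul0r, addr0, add0r) !eqxx.
pose v := (b * c - a * d) / c ^+ 2.
have v0 : v != 0.
  by rewrite /v mulf_neq0 ?invr_eq0 ?expf_neq0 // -opprB oppr_eq0.
have h3 : realizes 0 v 1 (d / c).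
  apply: (realizes_mulE _ h2 (realizes_dilation v v0)).
    by rewrite mul0r sub0r mulr1 oppr_eq0 oner_neq0.
  by rewrite !(mulr1, mul1r, mulr0, mul0r, addr0, add0r) !eqxx.
apply: (realizes_scale (x := c^-1)); rewrite ?invr_eq0 //.
apply: (realizes_mulE _ h3 (realizes_shift (a / c))).
  by rewrite mul0r sub0r mulr1 oppr_eq0.
rewrite !(mulr1, mul1r, mulr0, mul0r, addr0, add0r) mulVf // eqxx.
rewrite [a / c]mulrC [d / c]mulrC !eqxx /= andbT; apply/eqP.
have key (x y z t : K) : z != 0 -> (y * z - x * t) / z ^+ 2 + z^-1 * x * (z^-1 * t) = z^-1 * y.
  by move=> z0; field.
exact: (key a b c d c0).
Qed.

End Bruhat.

Lemma F5_ind (P : 'F_5 -> Prop) : P 0 -> P 1 -> P 2 -> P 3 -> P 4 -> forall x, P x.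
Proof.
move=> P0 P1 P2 P3 P4 [[|[|[|[|[|m]]]]] p] //.
- by rewrite (_ : Ordinal p = 0) //; apply: val_inj.
- by rewrite (_ : Ordinal p = 1) //; apply: val_inj.
- by rewrite (_ : Ordinal p = 2) //; apply: val_inj.
- by rewrite (_ : Ordinal p = 3) //; apply: val_inj.
- by rewrite (_ : Ordinal p = 4) //; apply: val_inj.
Qed.

Lemma line_ind (P : proj_line 'F_5 -> Prop) : P (Some 0) -> P (Some 1) ->
  P (Some 2) -> P (Some 3) -> P (Some 4) -> P None -> forall z, P z.
Proof. by move=> P0 P1 P2 P3 P4 PN [z|] //; elim/F5_ind: z. Qed.

Section Field5.
Variable H : {group {perm proj_line 'F_5}}.
Hypotheses (hT : realizes H 1 1 0 1) (hS : realizes H 2 0 0 1) (hI : realizes H 0 1 1 0).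

Lemma realizes_shift u : realizes H 1 u 0 1.
Proof.
have [n ->] : exists n, u = n%:R by exists (u : nat); rewrite natr_Zp.
elim: n => [|n IHn].
  by exists 1%g => // z; rewrite perm1 moebius1.
apply: (realizes_mulE _ IHn hT).
  by rewrite mulr0 subr0 mulr1 oner_neq0.
by rewrite !(mulr1, mul1r, mulr0, mul0r, addr0, add0r) natr1 !eqxx.
Qed.

Lemma realizes_dilation v : v != 0 -> realizes H v 0 0 1.
Proof.
have S2 : realizes H 4 0 0 1 by apply: (realizes_mulE _ hS hS).
have S3 : realizes H 3 0 0 1 by apply: (realizes_mulE _ hS S2).
elim/F5_ind: v.
- by move=> /eqP[].
- move=> _.
  by exists 1%g => [|z]; [apply: group1 | rewrite perm1 moebius1].
- by move=> _; exact: hS.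
- by move=> _; exact: S3.
by move=> _; exact: S2.
Qed.

Lemma PGL2_5_sub : PGL2 'F_5 \subset H.
Proof. exact: PGL2_bruhat realizes_shift realizes_dilation hI. Qed.

End Field5.
End PGL.

Section SymmetricFive.
Local Open Scope ring_scope.
Import GRing.Theory.

Lemma moebius_inv (K : finFieldType) (a b c d : K) z : a * d - b * c != 0 ->
  moebius d (- b) (- c) a (moebius a b c d z) = z.
Proof.
move=> h; rewrite moebius_comp //.
have -> : d * a + - b * c = (a * d - b * c) * 1 by ring.
have -> : d * b + - b * d = (a * d - b * c) * 0 by ring.
have -> : - c * a + a * c = (a * d - b * c) * 0 by ring.
have -> : - c * b + a * d = (a * d - b * c) * 1 by ring.
by rewrite moebius_scale // moebius1.
Qed.

Lemma PGL2_exists (K : finFieldType) (a b c d : K) : a * d - b * c != 0 ->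
  exists2 g, g \in PGL2 K & g =1 moebius a b c d.
Proof.
move=> h; have inj : injective (moebius a b c d).
  by apply: (can_inj (g := moebius d (- b) (- c) a)) => z; apply: moebius_inv.
exists (perm inj) => [|z]; last by rewrite permE.
by apply/PGL2P; exists a, b, c, d; split=> // z; rewrite permE.
Qed.

(* The 1-factorization of the complete graph on the projective line over F_5
   that PGL_2(5) preserves: M i is the involution pairing i with the point at
   infinity and x with 2i - x. The action on its five factors is S_5. *)
Definition factor (i : 'F_5) (z : proj_line 'F_5) : proj_line 'F_5 :=
  if z is Some x then (if x == i then None else Some (2 * i - x)) else Some i.

Definition permutes (s : {perm proj_line 'F_5}) (p : {perm 'F_5}) : bool :=
  [forall i, forall z, s (factor i z) == factor (p i) (s z)].

Implicit Types (s t : {perm proj_line 'F_5}) (p q : {perm 'F_5}).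

Lemma permutesP s p :
  reflect (forall i z, s (factor i z) = factor (p i) (s z)) (permutes s p).
Proof.
apply: (iffP forallP) => h i; last by apply/forallP=> z; rewrite h.
by move=> z; apply/eqP; apply: (forallP (h i)).
Qed.

Lemma permutes1 : permutes 1 1.
Proof. by apply/permutesP=> i z; rewrite !perm1. Qed.

Lemma permutesM s t p q : permutes s p -> permutes t q -> permutes (s * t) (p * q).
Proof.
by move=> /permutesP sp /permutesP tq; apply/permutesP=> i z; rewrite !permM sp tq.
Qed.

Lemma permutesV s p : permutes s p -> permutes s^-1 p^-1.
Proof.
move=> /permutesP sp; apply/permutesP=> i z; apply: (@perm_inj _ s).
by rewrite sp !permKV.
Qed.

Lemma permutes_id p : permutes 1 p -> p = 1%g.
Proof.
move/permutesP=> sp; apply/permP=> i; have := sp i None.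
by rewrite !perm1 => -[].
Qed.

Lemma permutes_faithful s : permutes s 1 -> s = 1%g.
Proof.
move/permutesP=> s1; have sE i z : s (factor i z) = factor i (s z) by rewrite s1 perm1.
have sS i : s (Some i) = factor i (s None) by rewrite -sE.
case E : (s None) => [j|]; last first.
  by apply/permP=> -[i|]; rewrite perm1 // sS E.
have := sE (j + 1) (Some j); rewrite sS E /=.
by elim/F5_ind: j E => E; rewrite /= sS E.
Qed.

Definition dual_shift : {perm 'F_5} := perm (addIr (1 : 'F_5)).

Lemma dual_dilation_inj : injective (fun i : 'F_5 => 2 * i).
Proof. by apply: mulfI. Qed.
Definition dual_dilation : {perm 'F_5} := perm dual_dilation_inj.

Lemma dual_inversion_inj : injective (fun i : 'F_5 => 3 / i).
Proof. by move=> i j /(mulfI (isT : (3 : 'F_5) != 0))/invr_inj. Qed.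
Definition dual_inversion : {perm 'F_5} := perm dual_inversion_inj.

Lemma permutes_check s p : (forall i z, s (factor i z) == factor (p i) (s z)) ->
  permutes s p.
Proof. by move=> h; apply/permutesP=> i z; apply/eqP. Qed.

Lemma permutes_shift s : s =1 moebius 1 1 0 1 -> permutes s dual_shift.
Proof.
move=> sE; apply: permutes_check => i z; rewrite !sE permE.
by elim/F5_ind: i; elim/line_ind: z.
Qed.

Lemma permutes_dilation s : s =1 moebius 2 0 0 1 -> permutes s dual_dilation.
Proof.
move=> sE; apply: permutes_check => i z; rewrite !sE permE.
by elim/F5_ind: i; elim/line_ind: z.
Qed.

Lemma permutes_inversion s : s =1 moebius 0 1 1 0 -> permutes s dual_inversion.
Proof.
move=> sE; apply: permutes_check => i z; rewrite !sE permE.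
by elim/F5_ind: i; elim/line_ind: z.
Qed.

Lemma PGL2_permutes s : s \in PGL2 'F_5 -> exists p, permutes s p.
Proof.
have [g1 _ E1] := @PGL2_exists 'F_5 1 1 0 1 isT.
have [g2 _ E2] := @PGL2_exists 'F_5 2 0 0 1 isT.
have [g3 _ E3] := @PGL2_exists 'F_5 0 1 1 0 isT.
pose A := g1 |: [set g2; g3].
have sA : PGL2 'F_5 \subset <<A>>.
  apply: PGL2_5_sub; [exists g1 | exists g2 | exists g3] => //;
    by rewrite mem_gen // !inE eqxx ?orbT.
move/(subsetP sA); elim/gen_ind: s / => [|s t [p sp]].
  by exists 1%g; apply: permutes1.
rewrite !inE => /or3P[]/eqP->.
- by exists (p * dual_shift)%g; apply/permutesM/permutes_shift.
- by exists (p * dual_dilation)%g; apply/permutesM/permutes_dilation.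
by exists (p * dual_inversion)%g; apply/permutesM/permutes_inversion.
Qed.

Lemma permutes_PGL2 p : exists2 s, s \in PGL2 'F_5 & permutes s p.
Proof.
have [g1 G1 E1] := @PGL2_exists 'F_5 1 1 0 1 isT.
have [g2 G2 E2] := @PGL2_exists 'F_5 2 0 0 1 isT.
have [g3 G3 E3] := @PGL2_exists 'F_5 0 1 1 0 isT.
have X5 : #|'F_5| = 5 by rewrite card_Fp.
have oS : #[dual_shift]%g = #|'F_5|.
  rewrite X5; apply/prime_nt_dvdP => //.
    rewrite order_eq1; apply/eqP=> s1; have := permE (addIr (1 : 'F_5)) 0.
    by rewrite -/dual_shift s1 perm1 add0r => /eqP.
  rewrite order_dvdn; apply/eqP/permP=> i.
  rewrite !expgS expg0 mulg1 !permM /dual_shift !permE /=.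
  by apply/eqP; elim/F5_ind: i.
have := gen_tperm_circular_shift (x := 2 : 'F_5) (y := 3) _ isT oS.
rewrite X5 => /(_ isT) genS; have : p \in <<[set tperm (2 : 'F_5) 3; dual_shift]>>.
  by rewrite genS inE.
elim/gen_ind: p / => [|p q [s sG sp]].
  by exists 1%g; [apply: group1 | apply: permutes1].
rewrite !inE => /orP[]/eqP->; last first.
  exists (s * g1)%g; first by rewrite (@groupM _ (PGL2_group 'F_5)).
  by apply: permutesM (permutes_shift E1).
exists (s * (g3 * g2))%g; first by rewrite !(@groupM _ (PGL2_group 'F_5)).
apply: permutesM => //.
have -> : tperm (2 : 'F_5) 3 = (dual_inversion * dual_dilation)%g.
  apply/permP=> i; rewrite permM /dual_inversion /dual_dilation !permE /=.
  by apply/eqP; elim/F5_ind: i.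
exact: permutesM (permutes_inversion E3) (permutes_dilation E2).
Qed.

Lemma PGL2_5_isog : PGL2 'F_5 \isog 'Sym_('F_5).
Proof.
pose phi s := odflt 1%g [pick p | permutes s p].
have uniq s p q : permutes s p -> permutes s q -> p = q.
  move=> /permutesV sp sq; apply/eqP; rewrite eq_mulVg1; apply/eqP/permutes_id.
  by rewrite -(mulVg s); apply: permutesM.
have phiE s p : permutes s p -> phi s = p.
  move=> sp; rewrite /phi; case: pickP => [q sq | /(_ p)]; last by rewrite sp.
  exact: uniq sq sp.
have phiM : {in PGL2_group 'F_5 &, {morph phi : s t / (s * t)%g}}.
  move=> s t /PGL2_permutes[p sp] /PGL2_permutes[q tq].
  by rewrite (phiE _ _ sp) (phiE _ _ tq); apply: phiE; apply: permutesM.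
apply/isogP; exists (Morphism phiM).
  apply/subsetP=> s /morphpreP[sG]; rewrite !inE /= => /eqP.
  have [p sp] := PGL2_permutes sG; rewrite (phiE _ _ sp) => p1.
  by apply/eqP/permutes_faithful; rewrite -p1.
apply/setP=> p; rewrite [RHS]inE; apply/morphimP.
by have [s sG sp] := permutes_PGL2 p; exists s; rewrite //= (phiE _ _ sp).
Qed.

End SymmetricFive.

Lemma PGL2_5_isog_S5 : PGL2 'F_5 \isog 'Sym_('I_5).
Proof. exact: PGL2_5_isog. Qed.

(** * The exceptional figures *)

Section SinglePiece.
Local Open Scope ring_scope.
Variables (k : nat) (F : figure).
Hypothesis k1 : (1 < k)%N.
Local Notation G := (puzzle_group k F).

Lemma admissible_is_piece : admissible k F -> #|` F|%fset = (k * k.+1)%N ->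
  is_piece k F.
Proof.
move=> /admissible_piece_sub[R pR RF] F6.
by have /eqP <- : R == F by rewrite eqEfcard RF F6 (card_piece pR) leqnn.
Qed.

Lemma piece_generated : is_piece k F ->
  exists (e : crd -> F) (a b : {perm F}),
  [/\ acts e (cdom k) a (rot k 0 0), acts e (cdom k) b (rot k 1 0),
      {in cdom k &, injective e}, forall t, exists2 c, cdom k c & t = e c
    & G = <<[set a; b]>> :> {set {perm F}} /\
      exists tau p, forall c, cdom k c -> val (e c) = place tau p c].
Proof.
move=> pF; have [tau [p [e [a aG [b bG [aa ab eE eF]]]]]] :=
  piece_chart k1 pF (fsubset_refl F).
have e_surj t : exists2 c, cdom k c & t = e c by apply/eF/fsvalP.
exists e, a, b; split=> //; first exact: place_chart_inj eE.
split; last by exists tau, p.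
apply/eqP; rewrite eqEsubset !gen_subG; apply/andP; split; last first.
  by apply/subsetP=> s; rewrite !inE => /orP[]/eqP->.
apply/subsetP=> s /movesP[q /fsubsetP qF st].
have inF t : t \in F -> exists2 c, cdom k c & t = place tau p c.
  by move=> tF; have [c dc tc] := e_surj [` tF]%fset; exists c; rewrite // -eE // -tc.
have [[u v] dc qE] : exists2 c, cdom k c & q = place tau p c.
  by apply/inF/qF; rewrite in_rect; case: (q) => x y /=; lia.
have [d dd q'E] : exists2 d, cdom k d & (q.1 + k%:Z - 1, q.2 + k%:Z - 1) = place tau p d.
  by apply/inF/qF; rewrite in_rect; case: (q) => x y /=; lia.
have [v0 u1] : v = 0%N /\ (u <= 1)%N.
  move: dc dd q'E; rewrite qE /cdom /place; case: (d) => [d1 d2].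
  by case: (tau) => /= ? ? []; lia.
subst v.
have key h : acts e (cdom k) h (rot k u 0) -> s = h \/ s = h^-1%g.
  move=> [hE _].
  have sE x : cdom k x -> s (e (if tau then rot k u 0 x else x))
                        = e (if tau then x else rot k u 0 x).
    move=> dx; have [dr _] := hE x dx; apply: val_inj.
    by rewrite st !eE ?qE ?turn_place //; case: (tau).
  case: (tau) sE => sE; [right | left].
    apply: (mulgI h); rewrite mulgV; apply/permP=> t; have [x dx ->] := e_surj t.
    by rewrite permM perm1 (hE x dx).2 sE.
  by apply/permP=> t; have [x dx ->] := e_surj t; rewrite (hE x dx).2 sE.
have aG' : a \in <<[set a; b]>> by rewrite mem_gen ?inE ?eqxx.
have bG' : b \in <<[set a; b]>> by rewrite mem_gen ?inE ?eqxx ?orbT.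
case: u u1 key {dc qE} => [|[|u]] // _ key.
  by have [-> | ->] := key a aa; rewrite ?groupV.
by have [-> | ->] := key b ab; rewrite ?groupV.
Qed.

End SinglePiece.

Section SixTiles.
Local Open Scope ring_scope.
Import GRing.Theory.

(* The letters false and true stand for the matrices of 2z and 3(z + 1)/z. *)
Definition word_mx (w : seq bool) : 'F_5 * 'F_5 * 'F_5 * 'F_5 :=
  foldl (fun m l => let: (a, b, c, d) := m in
    if l then (3 * a + 3 * c, 3 * b + 3 * d, 1 * a + 0 * c, 1 * b + 0 * d)
    else (2 * a + 0 * c, 2 * b + 0 * d, 0 * a + 1 * c, 0 * b + 1 * d)) (1, 0, 0, 1) w.

Lemma realizes_word (H : {group {perm proj_line 'F_5}}) w x a b c d :
    realizes H 2 0 0 1 -> realizes H 3 3 1 0 ->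
    word_mx w == (x * a, x * b, x * c, x * d) -> x != 0 ->
  realizes H a b c d.
Proof.
move=> hS hB /eqP wE x0; apply: (realizes_scale x0).
suff: let: (a, b, c, d) := word_mx w in a * d - b * c != 0 /\ realizes H a b c d.
  by rewrite wE => -[].
rewrite /word_mx; clear wE; elim/last_ind: w => [|w l].
  split; first by [].
  by exists 1%g => [|z]; [apply: group1 | rewrite perm1 moebius1].
rewrite foldl_rcons; case: (foldl _ _ _) => [[[p q] r] s] [h rh]; case: l; split.
- have -> : (3 * p + 3 * r) * (1 * q + 0 * s) - (3 * q + 3 * s) * (1 * p + 0 * r)
      = (- 3) * (p * s - q * r) by ring.
  by rewrite mulf_neq0.
- exact: realizes_mul.
- have -> : (2 * p + 0 * r) * (0 * q + 1 * s) - (2 * q + 0 * s) * (0 * p + 1 * r)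
      = 2 * (p * s - q * r) by ring.
  by rewrite mulf_neq0.
exact: realizes_mul.
Qed.

(* With this labelling the turns of the 3 x 2 piece become 2z and 3(z + 1)/z. *)
Definition corner (z : proj_line 'F_5) : crd :=
  if z is Some x then nth (0, 0)%N [:: (2, 1); (0, 0); (0, 1); (1, 0); (1, 1)]%N x
  else (2, 0)%N.

Lemma puzzle_six (F : figure) : is_piece 2 F -> #|` F|%fset = 6 ->
  exists2 f : F -> proj_line 'F_5, bijective f &
    forall s : {perm F}, s \in puzzle_group 2 F <->
      exists2 g, g \in PGL2 'F_5 & forall t, f (s t) = g (f t).
Proof.
move=> pF F6; have [e [a [b [aa ab e_inj _ [GE _]]]]] := piece_generated (isT : 1 < 2)%N pF.
have dC z : cdom 2 (corner z) by elim/line_ind: z.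
pose h z := e (corner z).
have h_inj : injective h.
  move=> y z /(e_inj _ _ (dC y) (dC z)).
  by elim/line_ind: y; elim/line_ind: z.
have [f fK hK] : bijective h.
  by apply: inj_card_bij => //; rewrite card_option card_Fp // -cardfE F6.
have [ga GA EA] := @PGL2_exists 'F_5 2 0 0 1 isT.
have [gb GB EB] := @PGL2_exists 'F_5 3 3 1 0 isT.
have hA z : a (h z) = h (ga z).
  by rewrite (aa.1 _ (dC z)).2 EA; congr e; elim/line_ind: z.
have hB z : b (h z) = h (gb z).
  by rewrite (ab.1 _ (dC z)).2 EB; congr e; elim/line_ind: z.
have toP s : s \in <<[set a; b]>> -> exists2 g, g \in PGL2 'F_5 & forall z, s (h z) = h (g z).
  elim/gen_ind: s / => [|s t [g gP sg]].
    by exists 1%g => [|z]; [apply: (group1 (PGL2_group 'F_5)) | rewrite !perm1].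
  rewrite !inE => /orP[]/eqP->; [exists (g * ga)%g | exists (g * gb)%g];
    by rewrite ?(@groupM _ (PGL2_group 'F_5)) // => z; rewrite !permM sg ?hA ?hB.
have sP : PGL2 'F_5 \subset <<[set ga; gb]>>.
  have rS : realizes <<[set ga; gb]>> 2 0 0 1 by exists ga; rewrite // mem_gen // !inE eqxx.
  have rB : realizes <<[set ga; gb]>> 3 3 1 0.
    by exists gb; rewrite // mem_gen // !inE eqxx orbT.
  apply: PGL2_5_sub => //.
    exact: (@realizes_word _ [:: true; true; false; true; true; true] 3 _ _ _ _ rS rB).
  exact: (@realizes_word _ [:: true; false; false; true; true; true; false; true] 2
            _ _ _ _ rS rB).
have ofP g : g \in PGL2 'F_5 -> exists2 s, s \in <<[set a; b]>> & forall z, s (h z) = h (g z).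
  move/(subsetP sP); elim/gen_ind: g / => [|g g' [s sG sg]].
    by exists 1%g => [|z]; [apply: group1 | rewrite !perm1].
  have aG : a \in <<[set a; b]>> by rewrite mem_gen ?inE ?eqxx.
  have bG : b \in <<[set a; b]>> by rewrite mem_gen ?inE ?eqxx ?orbT.
  rewrite !inE => /orP[]/eqP->; [exists (s * a)%g | exists (s * b)%g];
    by rewrite ?groupM // => z; rewrite !permM sg ?hA ?hB.
exists f => [|s]; first by exists h.
rewrite GE; split=> [/toP[g gP sg] | [g gP fg]].
  by exists g => // t; rewrite -{1}(hK t) sg fK.
have [s' s'G sg] := ofP g gP; suff -> : s = s' by [].
by apply/permP=> t; rewrite -(hK (s t)) fg -sg hK.
Qed.

End SixTiles.

Definition dark_tiles : seq crd := [:: (0, 0); (0, 2); (1, 1); (2, 0); (2, 2); (3, 1)].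
Definition light_tiles : seq crd := [:: (0, 1); (1, 0); (1, 2); (2, 1); (3, 0); (3, 2)].

(* The outer automorphism of S_6: the six light tiles of the 4 x 3 piece are
   identified with the six 1-factorizations of the complete graph on its dark
   tiles. A factor is listed as the involution pairing the dark tiles. *)
Definition factorizations : seq (seq (seq nat)) :=
  [:: [:: [:: 1; 0; 5; 4; 3; 2]; [:: 2; 3; 0; 1; 5; 4]; [:: 3; 5; 4; 0; 2; 1];
          [:: 4; 2; 1; 5; 0; 3]; [:: 5; 4; 3; 2; 1; 0]];
      [:: [:: 1; 0; 4; 5; 2; 3]; [:: 2; 3; 0; 1; 5; 4]; [:: 3; 4; 5; 0; 1; 2];
          [:: 4; 5; 3; 2; 0; 1]; [:: 5; 2; 1; 4; 3; 0]];
      [:: [:: 1; 0; 3; 2; 5; 4]; [:: 2; 5; 0; 4; 3; 1]; [:: 3; 4; 5; 0; 1; 2];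
          [:: 4; 2; 1; 5; 0; 3]; [:: 5; 3; 4; 1; 2; 0]];
      [:: [:: 1; 0; 5; 4; 3; 2]; [:: 2; 4; 0; 5; 1; 3]; [:: 3; 2; 1; 0; 5; 4];
          [:: 4; 5; 3; 2; 0; 1]; [:: 5; 3; 4; 1; 2; 0]];
      [:: [:: 1; 0; 3; 2; 5; 4]; [:: 2; 4; 0; 5; 1; 3]; [:: 3; 5; 4; 0; 2; 1];
          [:: 4; 3; 5; 1; 0; 2]; [:: 5; 2; 1; 4; 3; 0]];
      [:: [:: 1; 0; 4; 5; 2; 3]; [:: 2; 5; 0; 4; 3; 1]; [:: 3; 2; 1; 0; 5; 4];
          [:: 4; 3; 5; 1; 0; 2]; [:: 5; 4; 3; 2; 1; 0]]].

(* The partner of u in the factor of w through the edge {x, y}. *)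
Definition partner (w x y u : nat) : nat :=
  nth 0 (head [::] [seq s <- nth [::] factorizations w | nth 0 s x == y]) u.

Definition dark (x : nat) : crd := nth (0, 0) dark_tiles x.
Definition light (w : nat) : crd := nth (0, 0) light_tiles w.
Definition dark_map (f : crd -> crd) (x : nat) : nat := index (f (dark x)) dark_tiles.
Definition light_map (f : crd -> crd) (w : nat) : nat := index (f (light w)) light_tiles.

Definition equivariant (f : crd -> crd) : bool :=
  all (fun x => (dark_map f x < 6) && (f (dark x) == dark (dark_map f x))) (iota 0 6)
  && all (fun w => (light_map f w < 6) && (f (light w) == light (light_map f w))) (iota 0 6)
  && all (fun w => all (fun x => all (fun y => all (fun u => (x == y) ||
    (dark_map f (partner w x y u)
      == partner (light_map f w) (dark_map f x) (dark_map f y) (dark_map f u)))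
    (iota 0 6)) (iota 0 6)) (iota 0 6)) (iota 0 6).

Lemma equivariant_rot : equivariant (rot 3 0 0) && equivariant (rot 3 1 0).
Proof. by vm_compute. Qed.

Lemma partner_lt w x y u : w < 6 -> x < 6 -> y < 6 -> u < 6 -> partner w x y u < 6.
Proof.
have H : all (fun w => all (fun x => all (fun y => all (fun u => partner w x y u < 6)
    (iota 0 6)) (iota 0 6)) (iota 0 6)) (iota 0 6) by vm_compute.
have i6 i : i < 6 -> i \in iota 0 6 by rewrite mem_iota.
move=> /i6 w6 /i6 x6 /i6 y6 /i6 u6.
by move/allP/(_ w w6)/allP/(_ x x6)/allP/(_ y y6)/allP/(_ u u6): H.
Qed.

Lemma partner_inj w w' : w < 6 -> w' < 6 ->
  (forall x y u, x < 6 -> y < 6 -> u < 6 -> x != y -> partner w x y u = partner w' x y u) ->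
  w = w'.
Proof.
have H : all (fun w => all (fun w' => (w == w') || has (fun x => has (fun y => has (fun u =>
    (x != y) && (partner w x y u != partner w' x y u))
    (iota 0 6)) (iota 0 6)) (iota 0 6)) (iota 0 6)) (iota 0 6) by vm_compute.
move=> w6 w6' E; have := H.
move/allP/(_ w); rewrite mem_iota => /(_ w6)/allP/(_ w'); rewrite mem_iota => /(_ w6').
case/orP=> [/eqP // | /hasP[x]]; rewrite mem_iota => x6 /hasP[y]; rewrite mem_iota => y6.
case/hasP=> u; rewrite mem_iota => u6 /andP[xy]; by rewrite E ?eqxx.
Qed.

Section TwelveTiles.
Variables (T : finType) (e : crd -> T) (a b : {perm T}) (O : {set T}).
Hypothesis e_inj : {in cdom 3 &, injective e}.
Hypothesis e_surj : forall t, exists2 c, cdom 3 c & t = e c.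
Hypothesis acts_a : acts e (cdom 3) a (rot 3 0 0).
Hypothesis acts_b : acts e (cdom 3) b (rot 3 1 0).
Hypothesis OE : forall c, cdom 3 c -> (e c \in O) = ~~ odd (c.1 + c.2).
Local Notation G := <<[set a; b]>>.

Lemma dark_dom x : x < 6 -> cdom 3 (dark x) && ~~ odd ((dark x).1 + (dark x).2).
Proof. by do 6?[case: x => [|x] //]. Qed.

Lemma light_dom x : x < 6 -> cdom 3 (light x).
Proof. by do 6?[case: x => [|x] //]. Qed.

Lemma dark_inj : {in gtn 6 &, injective dark}.
Proof. by move=> x y x6 y6 /eqP; rewrite nth_uniq // => /eqP. Qed.

Lemma mem_dark c : cdom 3 c -> ~~ odd (c.1 + c.2) -> exists2 x, x < 6 & c = dark x.
Proof.
move=> dc ec; exists (index c dark_tiles); rewrite ?index_mem ?/dark ?nth_index //;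
  by case: c dc ec => [[|[|[|[|?]]]] [|[|[|?]]]].
Qed.

Lemma mem_light c : cdom 3 c -> odd (c.1 + c.2) -> exists2 x, x < 6 & c = light x.
Proof.
move=> dc ec; exists (index c light_tiles); rewrite ?index_mem ?/light ?nth_index //;
  by case: c dc ec => [[|[|[|[|?]]]] [|[|[|?]]]].
Qed.

Definition natural (g : {perm T}) (p q : nat -> nat) : Prop :=
  [/\ forall x, x < 6 -> p x < 6 /\ g (e (dark x)) = e (dark (p x)),
      forall w, w < 6 -> q w < 6 /\ g (e (light w)) = e (light (q w))
    & forall w x y u, w < 6 -> x < 6 -> y < 6 -> u < 6 -> x != y ->
        p (partner w x y u) = partner (q w) (p x) (p y) (p u)].

Lemma natural_gen h f : acts e (cdom 3) h f -> equivariant f ->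
  natural h (dark_map f) (light_map f).
Proof.
move=> ah /andP[/andP[/allP fd /allP fl] fp].
have i6 i : i < 6 -> i \in iota 0 6 by rewrite mem_iota.
split=> [x x6 | w w6 | ].
- have /andP[? /eqP fx] := fd x (i6 x x6).
  by have /andP[dx _] := dark_dom x6; rewrite (ah.1 _ dx).2 fx.
- have /andP[? /eqP fw] := fl w (i6 w w6).
  by rewrite (ah.1 _ (light_dom w6)).2 fw.
move=> w x y u /i6 w6 /i6 x6 /i6 y6 /i6 u6 /negPf xy.
move/allP/(_ w w6)/allP/(_ x x6)/allP/(_ y y6)/allP/(_ u u6): fp.
by rewrite xy => /eqP.
Qed.

Lemma natural_group g : g \in G -> exists p q, natural g p q.
Proof.
elim/gen_ind: g / => [|g h [p [q [gp gq gn]]]].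
  by exists id, id; split=> *; rewrite ?perm1.
have step f : acts e (cdom 3) h f -> equivariant f -> exists p q, natural (g * h)%g p q.
  move=> ah /(natural_gen ah)[hp hq hn]; exists (dark_map f \o p), (light_map f \o q).
  split=> [x x6 | w w6 | w x y u w6 x6 y6 u6 xy].
  - by have [p6 E] := gp x x6; have [? E'] := hp _ p6; rewrite permM E E'.
  - by have [q6 E] := gq w w6; have [? E'] := hq _ q6; rewrite permM E E'.
  rewrite /= gn //; have [px _] := gp x x6; have [py _] := gp y y6.
  have [pu _] := gp u u6; have [qw _] := gq w w6; rewrite hn //.
  apply: contraNneq xy => E; have := congr1 (e \o dark) E; rewrite /=.
  have /andP[dx _] := dark_dom x6; have /andP[dy _] := dark_dom y6.
  rewrite -(gp x x6).2 -(gp y y6).2 => /perm_inj/(e_inj dx dy)/dark_inj -> //.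
rewrite !inE => /orP[]/eqP hE; rewrite hE in step *.
  by apply: step acts_a _; case/andP: equivariant_rot.
by apply: step acts_b _; case/andP: equivariant_rot.
Qed.

Lemma light_faithful g : g \in G -> (forall t, t \in O -> g t = t) -> g = 1%g.
Proof.
move=> /natural_group[p [q [gp gq gn]]] gO.
have pE x : x < 6 -> p x = x.
  move=> x6; have [px gx] := gp x x6; have /andP[dx ex] := dark_dom x6.
  have /andP[dpx _] := dark_dom px; apply/dark_inj => //.
  by apply: (e_inj dpx dx); rewrite -gx gO // OE.
have qE w : w < 6 -> q w = w.
  move=> w6; have [qw _] := gq w w6; apply: partner_inj => // x y u x6 y6 u6 xy.
  by have := gn w x y u w6 x6 y6 u6 xy; rewrite !pE ?partner_lt.
apply/permP=> t; rewrite perm1; have [c dc ->] := e_surj t.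
have [oc | ec] := boolP (odd (c.1 + c.2)); last by rewrite gO // OE.
by have [w w6 ->] := mem_light dc oc; have [_ ->] := gq w w6; rewrite qE.
Qed.

Hypothesis GO : {subset G <= 'N(O | 'P)}.

Lemma restr_tri : tri (restr_perm O @* G) O.
Proof.
have GN : G \subset 'N(O | 'P) by apply/subsetP.
have aG : a \in G by rewrite mem_gen ?inE ?eqxx.
have bG : b \in G by rewrite mem_gen ?inE ?eqxx ?orbT.
pose s := ((b * a * b) ^+ 2)%g.
have sG : s \in G by rewrite groupX // !groupM.
have as_ := acts_exp 2 (acts_mul (acts_mul acts_b acts_a) acts_b).
have d1 : cdom 3 (0, 0) by []. have d2 : cdom 3 (3, 1) by []. have d3 : cdom 3 (0, 2) by [].
have sE : restr_perm O s = cycle3 (e (0, 0)) (e (3, 1)) (e (0, 2)).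
  have rO t : t \in O -> restr_perm O s t = s t.
    by move=> tO; apply: restr_permE => //; apply: GO.
  apply: cycle3_eq; rewrite ?(inj_in_eq e_inj) //.
  - by rewrite rO ?OE // (as_.1 _ d1).2.
  - by rewrite rO ?OE // (as_.1 _ d2).2.
  - by rewrite rO ?OE // (as_.1 _ d3).2.
  move=> t t1 t2 t3; have [tO | tO] := boolP (t \in O); last first.
    by apply: (out_perm (restr_perm_on _ _)).
  rewrite rO //; have [c dc tc] := e_surj t; move: tO t1 t2 t3; rewrite tc OE //.
  rewrite !(inj_in_eq e_inj) // (as_.1 _ dc).2 => /(mem_dark dc)[x x6 ->].
  by do 6?[case: x x6 => [|x] x6 //].
have s_im : restr_perm O s \in restr_perm O @* G.
  by rewrite mem_morphim //; apply: GO.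
rewrite sE in s_im.
have n12 : e (0, 0) != e (3, 1) by rewrite (inj_in_eq e_inj).
have n23 : e (3, 1) != e (0, 2) by rewrite (inj_in_eq e_inj).
have n13 : e (0, 0) != e (0, 2) by rewrite (inj_in_eq e_inj).
have tA := tri_cycle3 n12 n23 n13 s_im.
have A3 : 2 < #|[set e (0, 0); e (3, 1); e (0, 2)]|.
  by rewrite -setUA cardsU1 cards2 !inE negb_or n12 n13 n23.
pose H := [set restr_perm O a; restr_perm O b].
have HG : H \subset restr_perm O @* G.
  by apply/subsetP=> h; rewrite !inE => /orP[]/eqP->; rewrite mem_morphim // GO.
have [|D [sAD tD Dst]] := tri_spread A3 tA HG.
  move=> h; rewrite !inE => /orP[]/eqP->.
    exists (e (3, 1)); first by rewrite !inE eqxx orbT.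
    by rewrite restr_permE ?GO ?OE // (acts_a.1 _ d2).2.
  exists (e (0, 0)); first by rewrite !inE eqxx.
  by rewrite restr_permE ?GO ?OE // (acts_b.1 _ d1).2.
have rH g : g \in G -> restr_perm O g \in <<H>>.
  move=> gG; suff [] : g \in G /\ restr_perm O g \in <<H>> by [].
  elim/gen_ind: g / gG => [|g h [gG gH] hab]; first by rewrite morph1 !group1.
  have hG := mem_gen hab; rewrite groupM // morphM ?GO //; split=> //.
  rewrite groupM // mem_gen //; move: hab.
  by rewrite !inE => /orP[]/eqP->; rewrite eqxx ?orbT.
apply: triS tD; apply/subsetP=> t tO; have [c dc tc] := e_surj t.
have ec : ~~ odd (c.1 + c.2) by rewrite -OE // -tc.
have [|g gG gE] := link_piece (isT : 1 < 3) acts_a acts_b d1 dc.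
  by rewrite /= (negPf ec).
rewrite tc -gE -(restr_permE (GO gG)) ?OE //.
by apply: Dst (rH g gG); apply: (subsetP sAD); rewrite !inE eqxx.
Qed.

End TwelveTiles.

Lemma sym_on_isog (T : finType) (O : {set T}) n : #|O| = n ->
  sym_on O \isog 'Sym_('I_n).
Proof.
move=> On; pose f (i : 'I_n) := enum_val (cast_ord (esym On) i).
have f_inj : injective f by move=> i j /enum_val_inj/cast_ord_inj.
have fO i : f i \in O by apply: enum_valP.
have f_surj t : t \in O -> exists i, f i = t.
  move=> tO; exists (cast_ord On (enum_rank_in tO t)).
  by rewrite /f cast_ordK enum_rankK_in.
pose phi (s : {perm T}) : {perm 'I_n} :=
  odflt 1%g [pick p : {perm 'I_n} | [forall i, f (p i) == s (f i)]].
have phiE s : s \in sym_on O -> forall i, f (phi s i) = s (f i).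
  rewrite inE => sO; rewrite /phi; case: pickP => [p /forallP fp i | N]; first exact/eqP.
  pose q i := odflt i [pick j | f j == s (f i)].
  have fq i : f (q i) = s (f i).
    rewrite /q; case: pickP => [j /eqP // | M].
    by have [|j fj] := f_surj (s (f i)); [rewrite perm_closed | have := M j; rewrite fj eqxx].
  have q_inj : injective q.
    by move=> i j /(congr1 f); rewrite !fq => /perm_inj/f_inj.
  by have /forallP[] := N (perm q_inj) => i; rewrite permE fq.
have phiM : {in perm.Sym_group O &, {morph phi : s t / (s * t)%g}}.
  move=> s t sO tO; apply/permP=> i; apply: f_inj.
  by rewrite phiE ?groupM // !permM phiE // phiE.
have inj : 'injm (Morphism phiM).
  apply/subsetP=> s /morphpreP[sO]; rewrite !inE /= => /eqP s1; apply/eqP/permP=> t.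
  rewrite perm1; have [/f_surj[i <-] | tO] := boolP (t \in O).
    by rewrite -phiE // s1 perm1.
  by apply: out_perm tO; rewrite inE in sO.
apply/isogP; exists (Morphism phiM) => //; apply/eqP.
rewrite eqEcard subsetT card_injm // card_Sym perm.card_Sym On /=.
by rewrite card_ord.
Qed.

Section TwelveFacts.
Variables (T : finType) (e : crd -> T) (a b s0 : {perm T}) (O : {set T}).
Variable G : {group {perm T}}.
Hypothesis e_inj : {in cdom 3 &, injective e}.
Hypothesis e_surj : forall t, exists2 c, cdom 3 c & t = e c.
Hypothesis acts_a : acts e (cdom 3) a (rot 3 0 0).
Hypothesis acts_b : acts e (cdom 3) b (rot 3 1 0).
Hypothesis OE : forall c, cdom 3 c -> (e c \in O) = ~~ odd (c.1 + c.2).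
Hypothesis GE : G = <<[set a; b]>> :> {set {perm T}}.
Hypothesis GO : {subset G <= 'N(O | 'P)}.
Hypothesis s0G : s0 \in G.
Hypothesis s0_odd : odd_perm (restr_perm O s0).

Lemma twelve_card : #|O| = 6.
Proof.
have -> : O = [set e (dark x) | x : 'I_6].
  apply/setP=> t; apply/idP/imsetP => [tO | [x _ ->]]; last first.
    by have /andP[dx ex] := dark_dom (ltn_ord x); rewrite OE.
  have [c dc tc] := e_surj t; move: tO; rewrite tc OE // => /(mem_dark dc)[x x6 ->].
  by exists (Ordinal x6).
rewrite card_imset ?card_ord // => x y.
have /andP[dx _] := dark_dom (ltn_ord x); have /andP[dy _] := dark_dom (ltn_ord y).
by move=> /(e_inj dx dy)/dark_inj => E; apply/val_inj/E; rewrite inE ltn_ord.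
Qed.

Lemma twelve_restr : restr_perm O @* G = sym_on O.
Proof.
have r0 : restr_perm O s0 \in restr_perm O @* G by rewrite mem_morphim ?GO.
have GN : G \subset 'N(O | 'P) by apply/subsetP.
have tO : tri (restr_perm O @* G) O.
  by have := @restr_tri T e a b O e_inj e_surj acts_a acts_b OE; rewrite -GE; apply.
have aO := tri_alt_on (G := [group of restr_perm O @* G]) tO.
apply/eqP; rewrite eqEsubset; apply/andP; split.
  by apply/subsetP=> _ /morphimP[s _ _ ->]; rewrite inE restr_perm_on.
apply/subsetP=> u; rewrite inE => uO; have [uo | ue] := boolP (odd_perm u); last first.
  by apply: (subsetP aO); rewrite mem_alt_on uO.
rewrite -(groupMr _ r0); apply: (subsetP aO).
by rewrite mem_alt_on odd_permM uo s0_odd perm_onM // restr_perm_on.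
Qed.

Lemma twelve_orbit t : t \in O -> orbit 'P G t = O.
Proof.
move=> tO; apply/setP=> u; apply/orbitP/idP => [[g gG <-] | uO].
  by rewrite (astabs_act t (GO gG)).
have [c dc tc] := e_surj t; have [d dd ud] := e_surj u.
have [|g gG gE] := link_piece (isT : 1 < 3) acts_a acts_b dc dd.
  by move=> _; move: tO uO; rewrite tc ud !OE //; case: odd; case: odd.
by exists g; rewrite ?GE // tc ud.
Qed.

Lemma twelve_isog : G \isog 'Sym_('I_6).
Proof.
have GN : G \subset 'N(O | 'P) by apply/subsetP.
pose f := [morphism of restrm GN (restr_perm O)].
have inj : 'injm f.
  apply/subsetP=> g /morphpreP[gG]; rewrite !inE /= => /eqP g1; apply/eqP.
  have gH := gG; rewrite GE in gH.
  apply: (light_faithful e_inj e_surj acts_a acts_b OE gH) => t tO.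
  by rewrite -(restr_permE (GO gG) tO) -[restr_perm O g]/(f g) /= g1 perm1.
apply: isog_trans (sub_isog (subxx _) inj) _.
by rewrite /f /= morphim_restrm setIid twelve_restr; apply/sym_on_isog/twelve_card.
Qed.

End TwelveFacts.

Section PuzzleTwelve.
Variable F : figure.
Hypothesis pF : is_piece 3 F.
Local Notation G := (puzzle_group 3 F).

Lemma twelve_facts c : let O := black c F in
  [/\ #|O| = 6, restr_perm O @* G = sym_on O,
      forall t, t \in O -> orbit 'P G t = O & G \isog 'Sym_('I_6)].
Proof.
move=> O; have [e [a [b [aa ab e_inj e_surj [GE [tau [p eE]]]]]]] :=
  piece_generated (isT : 1 < 3) pF.
have GO : {subset G <= 'N(O | 'P)} by apply: puzzle_black.
have aF : admissible 3 F by apply: admissible_piece.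
have [s0 s0M] := moves_neq0 (isT : 0 < 3) aF.
have s0G : s0 \in G by apply: mem_gen.
have s0_odd : odd_perm (restr_perm O s0) by rewrite (odd_move_black (isT : 0 < 3)).
have OE i j : cdom 3 (i, j) ->
    (e (i, j) \in O) = (odd (i + j) == c (+) odd (absz (p.1 + p.2)%R)).
  move=> dij; rewrite -(hue_place tau p c i j (isT : odd 3)) -eE // inE.
  by rewrite /hue.
have [d0 | d1] := boolP (c (+) odd (absz (p.1 + p.2)%R)).
  have mK := @mirrorK 3; have inj' := inj_reindex mK e_inj.
  have aV : acts (e \o mirror 3) (cdom 3) b^-1 (rot 3 0 0).
    apply: acts_eq (acts_reindex mK (acts_inv ab (@unrot1K 3))) => d dd.
    exact: mirror_unrot1.
  have bV : acts (e \o mirror 3) (cdom 3) a^-1 (rot 3 1 0).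
    apply: acts_eq (acts_reindex mK (acts_inv aa (@unrotK 3))) => d dd.
    exact: mirror_unrot.
  have surj' t : exists2 d, cdom 3 d & t = (e \o mirror 3) d.
    have [d dd ->] := e_surj t; have [dm mm] := mK _ dd.
    by exists (mirror 3 d); rewrite //= mm.
  have OE' d : cdom 3 d -> ((e \o mirror 3) d \in O) = ~~ odd (d.1 + d.2).
    case: d => i j dd; have [dm _] := mK _ dd; rewrite /= OE // d0 eqb_id.
    by case/andP: dd => /= i3 _; rewrite !oddD oddB // addTb addNb.
  have GE' : G = <<[set b^-1; a^-1]>> :> {set {perm F}}.
    rewrite GE; apply/eqP; rewrite eqEsubset !gen_subG; apply/andP; split;
      apply/subsetP=> s; rewrite !inE => /orP[]/eqP->.
    - by rewrite -groupV mem_gen // !inE eqxx orbT.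
    - by rewrite -groupV mem_gen // !inE eqxx.
    - by rewrite groupV mem_gen // !inE eqxx orbT.
    by rewrite groupV mem_gen // !inE eqxx.
  split.
  - exact: twelve_card inj' surj' OE'.
  - exact: twelve_restr inj' surj' aV bV OE' GE' GO s0G s0_odd.
  - exact: twelve_orbit surj' aV bV OE' GE' GO.
  exact: twelve_isog inj' surj' aV bV OE' GE' GO s0G s0_odd.
have OE' d : cdom 3 d -> (e d \in O) = ~~ odd (d.1 + d.2).
  by case: d => i j dd; rewrite OE // (negPf d1) eqbF_neg.
split.
- exact: twelve_card e_inj e_surj OE'.
- exact: twelve_restr e_inj e_surj aa ab OE' GE GO s0G s0_odd.
- exact: twelve_orbit e_surj aa ab OE' GE GO.
exact: twelve_isog e_inj e_surj aa ab OE' GE GO s0G s0_odd.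
Qed.

Lemma puzzle_twelve :
  [/\ G \isog 'Sym_('I_6), #|[set orbit 'P G t | t : F]| = 2 &
      forall t : F, let O := orbit 'P G t in
        #|O| = 6 /\ restr_perm O @* G = sym_on O].
Proof.
have orbE t : exists c, orbit 'P G t = black c F.
  pose c := odd (absz ((val t).1 + (val t).2)%R); exists c.
  by have [_ _ oE _] := twelve_facts c; apply: oE; rewrite inE.
split; first by have [] := twelve_facts true.
  have nz c : exists t, t \in black c F.
    by apply/card_gt0P; have [-> _ _ _] := twelve_facts c.
  have -> : [set orbit 'P G t | t : F] = [set black true F; black false F].
    apply/setP=> O; apply/imsetP/set2P => [[t _ ->] | oE].
      by have [[] ->] := orbE t; [left | right].
    have [c ->] : exists c, O = black c F by case: oE => ->; [exists true | exists false].
    by have [t tc] := nz c; exists t; have [_ _ oE' _] := twelve_facts c; rewrite // oE'.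
  rewrite cards2; case: eqP => // E; have [t tT] := nz true.
  by have := tT; rewrite E; move: tT; rewrite !inE => /eqP->.
move=> t O; have [c ->] : exists c, O = black c F by apply: orbE.
by have [? ? _ _] := twelve_facts c.
Qed.

End PuzzleTwelve.

Theorem theorem1 (k n : nat) (F : figure) (hk : (1 < k)%N)
    (hF : admissible k F) (hn : #|` F|%fset = n) :
  let G := puzzle_group k F in
  [/\ (* k even *)
      ~~ odd k -> n <> 6 ->
        (k = 0 %[mod 4] -> G = ('Alt_F)%g :> {set {perm F}}) /\
        (k = 2 %[mod 4] -> G = ('Sym_F)%g :> {set {perm F}}),
      (* k odd; B is the set of black tiles *)
      odd k -> n <> 12 ->
        forall (c : bool) (m : nat), #|black c F| = m ->
        let B := black c F in
        let W := (~: B)%SET in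
        [/\ #|W| = n - m,
            k = 1 %[mod 8] \/ k = 7 %[mod 8] ->
              (alt_on B \x alt_on W)%g = G :> {set {perm F}},
            k = 3 %[mod 8] \/ k = 5 %[mod 8] ->
              G = even_prod B W :> {set {perm F}} &
            even_prod B W = [set s in (sym_on B * sym_on W)%g | ~~ odd_perm s]%SET],
      n = 6 ->
        (exists2 f : F -> proj_line 'F_5, bijective f &
           forall s : {perm F},
             s \in G <-> exists2 g, g \in PGL2 'F_5 & forall t, f (s t) = g (f t))
        /\ (PGL2 'F_5 \isog 'Sym_('I_5))%g &
      k = 3 -> n = 12 ->
        [/\ (G \isog 'Sym_('I_6))%g,
            #|[set orbit 'P G t | t : F]%SET| = 2 &
            forall t : F,
              let O := orbit 'P G t in
              #|O| = 6 /\ (restr_perm O @* G)%g = sym_on O]].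
Proof.
subst n; split.
- exact: puzzle_even.
- move=> ok F12 c m <-; split.
  + by rewrite cardsCs setCK cardfE.
  + by move=> km; apply: puzzle_dprod => //; lia.
  + by move=> km; apply: puzzle_even_prod => //; lia.
  exact: even_prodE.
- move=> F6; split; last exact: PGL2_5_isog_S5.
  have [R pR RF] := admissible_piece_sub hF.
  have k2 : k = 2.
    have := fsubset_leq_card RF; rewrite (card_piece pR) F6; clear -hk; nia.
  subst k; apply: puzzle_six => //.
  exact: admissible_is_piece.
move=> k3 F12; subst k; apply: puzzle_twelve.
exact: admissible_is_piece.
Qed.
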